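(* $\mathrm{Aut}(\mathbf{M})$ has the small index property: if $H$ is a subgroup of $G=\mathrm{Aut}(\mathbf{M})$ with $[G:H]<2^{\aleph_0}$, then $H$ is open in $G$ (with the topology of pointwise convergence).
   Context: Fix an integer $\mathfrak{m}\ge2$. Structures are graphs (one irreflexive symmetric binary relation $\mathcal{R}$; $\mathcal{R}(A)$ is the edge set). For finite $A$, $\delta(A)=\mathfrak{m}|A|-|\mathcal{R}(A)|$. For finite $A\subseteq B$, $A\leqslant B$ iff $\delta(A')\ge\delta(A)$ for all $A\subseteq A'\subseteq B$; for infinite $N$, $A\leqslant N$ iff $A\leqslant B$ for every finite $B\subseteq N$ containing $A$. $\mathsf{K_0}$ = finite graphs all of whose subgraphs have $\delta\ge0$. $\mathbf{M}$ (the ab-initio Hrushovski generic) is the unique countable graph that is a union of a chain of finite $\leqslant$-closed subsets, in which every isomorphism between finite $\leqslant$-closed subsets extends to an automorphism, and into which every member of $\mathsf{K_0}$ embeds as a $\leqslant$-closed subset. *)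

(* Defs.v *)
From HB Require Import structures.
From mathcomp Require Import all_boot all_order all_algebra.
Set Implicit Arguments. Unset Strict Implicit. Unset Printing Implicit Defensive.
Import Order.TTheory GRing.Theory Num.Theory.

(* Finite subsets of a vertex type are represented by sequences (duplicates
   are ignored via [undup]; set inclusion is [{subset _ <= _}]). *)

Definition graph_rel (T : eqType) (e : rel T) : Prop :=
  symmetric e /\ irreflexive e.

(* |R(A)|: number of (unordered) edges inside A.  The number of ordered
   pairs (x,y) in A x A with e x y is twice the number of edges, since e is
   symmetric and irreflexive. *)
Definition nedges (T : eqType) (e : rel T) (A : seq T) : nat :=
  (count (fun p : T * T => e p.1 p.2)
         [seq (x, y) | x <- undup A, y <- undup A])./2.

Definition delta (T : eqType) (e : rel T) (m : nat) (A : seq T) : int :=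
  ((m * size (undup A))%:Z - (nedges e A)%:Z)%R.

Definition sclosed (T : eqType) (e : rel T) (m : nat) (A B : seq T) : Prop :=
  {subset A <= B} /\
  forall A' : seq T, {subset A <= A'} -> {subset A' <= B} ->
    (delta e m A <= delta e m A')%R.

Definition sclosed_in_all (T : eqType) (e : rel T) (m : nat) (A : seq T) : Prop :=
  forall B : seq T, {subset A <= B} -> sclosed e m A B.

Definition inK0 (W : finType) (f : rel W) (m : nat) : Prop :=
  graph_rel f /\ forall A : seq W, (0 <= delta f m A)%R.

Definition is_aut (V : eqType) (e : rel V) (g : V -> V) : Prop :=
  bijective g /\ forall x y, e (g x) (g y) = e x y.

(* (V, e) is the ab-initio Hrushovski generic M for parameter m. *)
Definition is_generic (m : nat) (V : countType) (e : rel V) : Prop :=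
  graph_rel e /\
  (exists An : nat -> seq V,
      (forall n, {subset An n <= An n.+1}) /\
      (forall n, sclosed_in_all e m (An n)) /\
      (forall x, exists n, x \in An n)) /\
  (forall (A B : seq V) (f : V -> V),
      sclosed_in_all e m A -> sclosed_in_all e m B ->
      {in A &, injective f} ->
      (forall x, x \in A -> f x \in B) ->
      (forall y, y \in B -> exists2 x, x \in A & f x = y) ->
      (forall x y, x \in A -> y \in A -> e (f x) (f y) = e x y) ->
      exists g, is_aut e g /\ forall x, x \in A -> g x = f x) /\
  (forall (W : finType) (f : rel W), inK0 f m ->
      exists h : W -> V,
        injective h /\ (forall x y, e (h x) (h y) = f x y) /\
        sclosed_in_all e m (map h (enum W))).

Definition is_aut_subgroup (V : eqType) (e : rel V) (H : (V -> V) -> Prop) : Prop :=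
  (forall g, H g -> is_aut e g) /\
  H id /\
  (forall g h, H g -> H h -> H (g \o h)) /\
  (forall g g', H g -> (forall x, g' (g x) = x /\ g (g' x) = x) -> H g').

(* [G : H] >= 2^aleph_0: there are continuum many pairwise distinct left
   cosets g H (g in Aut). *)
Definition index_ge_continuum (V : eqType) (e : rel V) (H : (V -> V) -> Prop) : Prop :=
  exists F : (nat -> bool) -> (V -> V),
    (forall s, is_aut e (F s)) /\
    (forall s t, (exists h, H h /\ forall x, F t x = F s (h x)) -> s = t).

(* Openness in the topology of pointwise convergence on Aut(V, e):
   each point of H has a basic neighbourhood (agreement on a finite set)
   contained in H. *)
Definition open_in_Aut (V : eqType) (e : rel V) (H : (V -> V) -> Prop) : Prop :=
  forall g, H g -> exists A : seq V,
    forall g', is_aut e g' -> (forall x, x \in A -> g' x = g x) -> H g'.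

(* Main.v *)
Require Import Defs.
From mathcomp Require Import all_boot all_order all_algebra.
From mathcomp Require Import zify boolp.
Set Implicit Arguments. Unset Strict Implicit. Unset Printing Implicit Defensive.
Import Order.TTheory GRing.Theory Num.Theory.

(** Following Kechris and Rosendal: if [H] is not open, a binary tree of partial
    conjugations produces continuum many cosets, provided [Aut M] has enough mutually
    generic automorphisms. Genericity is understood as freeness rather than in the sense
    of Baire category, so finite partial automorphisms are never required to extend to
    automorphisms of finite strong subsets of [M]. Given automorphisms [u_i], an
    automorphism [w] fixing a finite strong set [C] is [generic_over] the [u_i] when every value or preimage of [w] outside [C] can be
    chosen freely over what was built before, in a way that is rich enough; freeness
    is expressed by a universal property for graphs with an action of the free group,
    which makes the order of the choices irrelevant. Then
    - two automorphisms generic over [(u_i, C)] are conjugate by an automorphism that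
      fixes [C] and commutes with all [u_i] (back and forth);
    - there is a perfect set of automorphisms [p_s] such that every quotient
      [p_s p_t^-1] with [s <> t] is generic over some large [C], so a subgroup of small
      index contains a generic automorphism;
    - every automorphism fixing [C] is a product of three generic ones, so a subgroup
      containing all generic automorphisms over [C] is open.
    If [H] has small index and is not open, then over every good system there are generic
    [w] in [H] and [w'] outside [H] that are conjugate by some [a] commuting with the
    system; adding [w] on one side and [w'] on the other side of each node of a binary tree,
    and twisting by [a^-1] on the second side, gives continuum many distinct cosets of [H]. *)

(** * The predimension *)

Section Predimension.
Variables (T : eqType) (e : rel T) (m : nat).
Hypothesis eG : graph_rel e.

Definition ecount (A B : seq T) : nat := \sum_(x <- A) \sum_(y <- B) e x y.

Lemma ecount_catl A A' B : ecount (A ++ A') B = ecount A B + ecount A' B.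
Proof. by rewrite /ecount big_cat. Qed.

Lemma ecount_catr A B B' : ecount A (B ++ B') = ecount A B + ecount A B'.
Proof. by rewrite /ecount -big_split; apply: eq_bigr => x _; rewrite big_cat. Qed.

Lemma ecountC A B : ecount A B = ecount B A.
Proof.
rewrite /ecount exchange_big; apply: eq_bigr => x _; apply: eq_bigr => y _.
by rewrite (eG.1 x y).
Qed.

Lemma ecount_perm A A' B B' :
  perm_eq A A' -> perm_eq B B' -> ecount A B = ecount A' B'.
Proof.
move=> pA pB; rewrite /ecount (perm_big _ pA) /=.
by apply: eq_bigr => x _; rewrite (perm_big _ pB).
Qed.

Lemma ecount_self_even A : ~~ odd (ecount A A).
Proof.
elim: A => [|x A IH]; first by rewrite /ecount big_nil.
rewrite -cat1s ecount_catl !ecount_catr (ecountC A [:: x]).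
have -> : ecount [:: x] [:: x] = 0 by rewrite /ecount !big_seq1 (eG.2 x).
by rewrite add0n addnA oddD addnn odd_double.
Qed.

(* Twice the predimension, which avoids the halving in [nedges]. *)
Definition delta2 (A : seq T) : int :=
  ((2 * m * size (undup A))%:Z - (ecount (undup A) (undup A))%:Z)%R.

Lemma nedgesE A : (nedges e A).*2 = ecount (undup A) (undup A).
Proof.
have count_pairs s t : count (fun p : T * T => e p.1 p.2)
    [seq (x, y) | x <- s, y <- t] = ecount s t.
  elim: s => [|x s IH] /=; first by rewrite /ecount big_nil.
  by rewrite /ecount big_cons count_cat IH count_map -sum1_count big_mkcond.
rewrite /nedges count_pairs.
by rewrite halfK (negbTE (ecount_self_even _)) subn0.
Qed.

Lemma delta_le A B : (delta e m A <= delta e m B)%R = (delta2 A <= delta2 B)%R.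
Proof. by rewrite /delta /delta2 -!nedgesE; apply/idP/idP; lia. Qed.

Lemma delta2_eqi A B : A =i B -> delta2 A = delta2 B.
Proof.
move=> AB.
have p : perm_eq (undup A) (undup B).
  by apply: uniq_perm; rewrite ?undup_uniq // => x; rewrite !mem_undup.
by rewrite /delta2 (perm_size p) (ecount_perm p p).
Qed.

Lemma delta2_uniq A : uniq A ->
  delta2 A = ((2 * m * size A)%:Z - (ecount A A)%:Z)%R.
Proof. by move=> uA; rewrite /delta2 undup_id. Qed.

Lemma delta2_cat A B : uniq (A ++ B) ->
  delta2 (A ++ B) = (delta2 A + delta2 B - (2 * ecount A B)%:Z)%R.
Proof.
move=> u; have := u; rewrite cat_uniq => /and3P [uA _ uB].
rewrite !delta2_uniq // size_cat ecount_catl !ecount_catr (ecountC B A); lia.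
Qed.

(** The edges between [A] and [B] are the only failure of modularity over [I]. Submodularity and the
    predimension of free amalgams are both read off this identity. *)
Lemma delta2_cat3 I A B : uniq (I ++ A ++ B) ->
  (delta2 (I ++ A ++ B) + delta2 I =
   delta2 (I ++ A) + delta2 (I ++ B) - (2 * ecount A B)%:Z)%R.
Proof.
move=> u; have := u.
rewrite !cat_uniq has_cat negb_or => /and3P [uI /andP [hA hB] /and3P [uA hAB uB]].
rewrite (delta2_cat u) delta2_cat ?cat_uniq ?uA ?uB ?hAB //.
rewrite !delta2_cat ?cat_uniq ?uI ?uA ?uB ?hA ?hB // ecount_catr; lia.
Qed.

End Predimension.

Lemma delta2_map (T T' : eqType) (e : rel T) (e' : rel T') m (f : T -> T') A :
  {in A &, injective f} -> {in A &, forall x y, e' (f x) (f y) = e x y} ->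
  delta2 e' m (map f A) = delta2 e m A.
Proof.
move=> injf fe; have p : perm_eq (undup (map f A)) (map f (undup A)).
  apply: uniq_perm; rewrite ?undup_uniq ?map_inj_in_uniq ?undup_uniq //.
    by move=> x y; rewrite !mem_undup; apply: injf.
  move=> y; rewrite mem_undup; apply/mapP/mapP => -[x xA ->]; exists x => //.
    by rewrite mem_undup.
  by rewrite -mem_undup.
rewrite /delta2 (perm_size p) (ecount_perm _ p p) size_map; congr (_ - _%:Z)%R.
rewrite /ecount big_map big_seq [RHS]big_seq; apply: eq_bigr => x.
rewrite mem_undup => xA; rewrite big_map big_seq [RHS]big_seq.
by apply: eq_bigr => y; rewrite mem_undup => yA; rewrite fe.
Qed.

(** * Strong sets and submodularity of the predimension *)

Section Strong.
Variables (V : eqType) (e : rel V) (m : nat).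
Hypothesis eG : graph_rel e.
Implicit Types (A B D T : seq V) (Z : V -> Prop).
Local Notation delta2 := (delta2 e m).

Definition cap T Z : seq V := [seq x <- T | `[< Z x >]].

Lemma mem_cap T Z x : (x \in cap T Z) = `[< Z x >] && (x \in T).
Proof. by rewrite mem_filter. Qed.

Lemma capP T Z x : reflect (Z x /\ x \in T) (x \in cap T Z).
Proof. by rewrite mem_cap; apply: (iffP andP) => -[/asboolP]. Qed.

(** Stating strength by intersections lets [Z] be infinite and makes closure under intersection
    immediate. For finite sets it agrees with [sclosed_in_all], by submodularity
    ([sclosed_strong]). *)
Definition Str Z := forall T, (delta2 (cap T Z) <= delta2 T)%R.
Definition strong A := Str (fun x => x \in A).

Lemma Str_cap Z Z' : Str Z -> Str Z' -> Str (fun x => Z x /\ Z' x).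
Proof.
move=> sZ sZ' T; apply: le_trans (sZ T); apply: le_trans (sZ' _).
rewrite (delta2_eqi e m (B := cap (cap T Z) Z')) // => x.
apply/capP/capP => [[[Zx Z'x] xT]|[Z'x /capP [Zx xT]]] //.
by split=> //; apply/capP.
Qed.

Lemma strong_cap A Z : strong A -> Str Z -> strong (cap A Z).
Proof.
move=> sA sZ T; have := Str_cap sA sZ T.
rewrite (delta2_eqi e m (B := cap T (fun x => x \in cap A Z))) // => x.
by apply/capP/capP => -[]; [move=> [? ?] ?; split=> //; apply/capP|move/capP=> [? ?]].
Qed.

Lemma strong_eqi A B : A =i B -> strong A -> strong B.
Proof.
move=> AB sA T; have := sA T.
rewrite (delta2_eqi e m (B := cap T (fun x => x \in B))) // => x.
by rewrite !mem_cap /= AB.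
Qed.

Lemma delta2_submodular T S :
  (delta2 (T ++ S) + delta2 (cap T (fun x => x \in S)) <= delta2 T + delta2 S)%R.
Proof.
pose I := [seq x <- undup T | x \in S].
pose T1 := [seq x <- undup T | x \notin S].
pose S1 := [seq x <- undup S | x \notin T].
have u : uniq (I ++ T1 ++ S1).
  rewrite !cat_uniq !filter_uniq ?undup_uniq //= has_cat negb_or !andbT.
  apply/andP; split; first (apply/andP; split); apply/hasPn => x;
    rewrite !mem_filter !mem_undup => /andP [/negbTE -> _] //; by rewrite andbF.
have := delta2_cat3 m eG u.
rewrite (delta2_eqi e m (B := T ++ S) (A := I ++ T1 ++ S1)); last first.
  move=> x; rewrite !mem_cat !mem_filter !mem_undup.
  by case: (x \in T); case: (x \in S).
rewrite (delta2_eqi e m (B := T) (A := I ++ T1)); last first.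
  move=> x; rewrite !mem_cat !mem_filter !mem_undup.
  by case: (x \in T); case: (x \in S).
rewrite (delta2_eqi e m (B := S) (A := I ++ S1)); last first.
  move=> x; rewrite !mem_cat !mem_filter !mem_undup.
  by case: (x \in T); case: (x \in S).
rewrite (delta2_eqi e m (B := cap T (fun x => x \in S)) (A := I)); last first.
  by move=> x; rewrite mem_cap mem_filter mem_undup asboolb.
lia.
Qed.

Lemma sclosed_strong A : sclosed_in_all e m A <-> strong A.
Proof.
split=> [sA T|sA B AB].
  have [|_ /(_ (T ++ A))] := sA (T ++ A).
    by move=> x; rewrite mem_cat orbC => ->.
  rewrite delta_le // => dA; have {}dA : (delta2 A <= delta2 (T ++ A))%R.
    by apply: dA => // x; rewrite mem_cat orbC => ->.
  by have := delta2_submodular T A; lia.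
split=> // A' AA' _; rewrite delta_le //; have := sA A'.
rewrite (delta2_eqi e m (B := A)) // => x.
by rewrite mem_cap asboolb; case xA: (x \in A) => //=; rewrite AA'.
Qed.

(** The deleted points send edges to the rest of [T] only inside [A]. Strength of [A] bounds the
    cost of their edges to [A] by their own predimension, so deleting them cannot raise the
    predimension of [T]. *)
Lemma delta2_peel A T (P : pred V) : strong A ->
  (forall x, x \in T -> P x -> x \notin A) ->
  (forall x y, x \in T -> P x -> y \in T -> ~~ P y -> e x y -> y \in A) ->
  (delta2 [seq x <- T | ~~ P x] <= delta2 T)%R.
Proof.
move=> sA PA PE.
pose D := [seq x <- undup T | P x]; pose R := [seq x <- undup T | ~~ P x].
have uRD : uniq (R ++ D).
  rewrite cat_uniq !filter_uniq ?undup_uniq //= andbT; apply/hasPn => x.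
  by rewrite !mem_filter => /andP [->].
have uAD : uniq (undup A ++ D).
  rewrite cat_uniq undup_uniq filter_uniq ?undup_uniq //= andbT; apply/hasPn => x.
  by rewrite !mem_filter !mem_undup => /andP [Px xT]; apply: PA.
rewrite (delta2_eqi e m (A := T) (B := R ++ D)); last first.
  by move=> x; rewrite mem_cat !mem_filter mem_undup -andb_orl orNb.
rewrite (delta2_eqi e m (B := R)); last first.
  by move=> x; rewrite !mem_filter mem_undup.
have := sA (undup A ++ D).
rewrite (delta2_eqi e m (B := undup A)); last first.
  move=> x; rewrite mem_cap asboolb mem_cat mem_undup.
  by case: (x \in A).
rewrite !delta2_cat //.
suff : ecount e R D <= ecount e (undup A) D by lia.
rewrite /ecount (bigID (fun x => x \in A)) /= [X in _ + X]big1_seq ?addn0; last first.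
  move=> x /andP [xA]; rewrite mem_filter mem_undup => /andP [Px xT].
  rewrite big1_seq // => y /andP [_]; rewrite mem_filter mem_undup => /andP [Py yT].
  case exy: (e x y) => //; case/negP: xA; apply: (PE y) => //.
  by rewrite (eG.1 y x).
rewrite -big_filter; apply: (uniq_sub_le_big leqnn (fun x y => leq_addr y x)).
- by rewrite filter_uniq // filter_uniq ?undup_uniq.
- exact: undup_uniq.
- by move=> x; rewrite mem_filter mem_undup => /andP [].
Qed.

End Strong.

(** * Automorphisms and independent extensions *)

Record aut (V : eqType) (e : rel V) := Aut {
  af :> V -> V;
  ab : V -> V;
  afK : cancel af ab;
  abK : cancel ab af;
  af_edge : forall x y, e (af x) (af y) = e x y }.

Section Automorphisms.
Variables (V : eqType) (e : rel V).
Implicit Types (f g : aut e).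

Lemma ab_edge f x y : e (ab f x) (ab f y) = e x y.
Proof. by rewrite -[LHS](af_edge f) !abK. Qed.

Lemma af_inj f : injective f. Proof. exact: can_inj (afK f). Qed.

Definition aid : aut e :=
  @Aut V e id id (fun _ => erefl) (fun _ => erefl) (fun _ _ => erefl).

Definition ainv f : aut e := Aut (abK f) (afK f) (ab_edge f).

Lemma acomp_edge f g x y : e (f (g x)) (f (g y)) = e x y.
Proof. by rewrite !af_edge. Qed.

Definition acomp f g : aut e :=
  @Aut V e (f \o g) (ab g \o ab f) (can_comp (afK f) (afK g))
    (can_comp (abK g) (abK f)) (acomp_edge f g).

Lemma is_aut_aut (g : V -> V) : is_aut e g -> exists a : aut e, af a = g.
Proof. by case=> -[h hK Kh] ge; exists (Aut hK Kh ge). Qed.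

Lemma aut_is_aut f : is_aut e f.
Proof. by split; [exists (ab f); [exact: afK|exact: abK]|exact: af_edge]. Qed.

Lemma mem_map_aut f x (A : seq V) : (f x \in map f A) = (x \in A).
Proof. exact: mem_map (@af_inj f) _ _. Qed.

Lemma mem_map_autV f x (A : seq V) : (x \in map f A) = (ab f x \in A).
Proof. by rewrite -{1}(abK f x) mem_map_aut. Qed.

End Automorphisms.

Section Generic.
Variables (m : nat) (V : countType) (e : rel V).
Hypothesis HM : is_generic m e.
Implicit Types (A B D T : seq V).
Local Notation strong := (strong e m).
Local Notation aut := (aut e).
Let eG : graph_rel e := HM.1.

Lemma strong_map (g : aut) A : strong A -> strong (map g A).
Proof.
move=> sA T; have := sA (map (ab g) T).
have -> : delta2 e m (map (ab g) T) = delta2 e m T.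
  apply: delta2_map => [x y _ _|x y _ _]; last exact: ab_edge.
  exact: can_inj (abK g) _ _.
suff -> : delta2 e m (cap T (fun x => x \in map g A)) =
    delta2 e m (cap (map (ab g) T) (fun x => x \in A)) by [].
rewrite -[RHS](delta2_map m (f := g) (e' := e)).
- apply: delta2_eqi => x; rewrite mem_map_autV !mem_cap !asboolb mem_map_autV.
  congr (_ && _); apply/idP/mapP => [xT|[y yT /(can_inj (abK g)) ->]] //.
  by exists x.
- by move=> x y _ _; apply: af_inj.
- by move=> x y _ _; apply: af_edge.
Qed.

Lemma homogeneity A (f : V -> V) :
  strong A -> strong (map f A) -> {in A &, injective f} ->
  {in A &, forall x y, e (f x) (f y) = e x y} ->
  exists g : aut, {in A, g =1 f}.
Proof.
move=> sA sfA injf fe; case: HM => _ [_ [hom _]].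
have [| | | | | |g [/is_aut_aut [a <-] ga]] := hom A (map f A) f.
- exact/(sclosed_strong m eG).
- exact/(sclosed_strong m eG).
- by [].
- by move=> x xA; apply: map_f.
- by move=> y /mapP [x xA ->]; exists x.
- by move=> x y xA yA; apply: fe.
by exists a => x xA; apply: ga.
Qed.

Lemma strong_hull A : exists2 B, strong B & {subset A <= B}.
Proof.
case: HM => _ [[An [Asub [Ascl Aall]]] _].
have Amono i j : i <= j -> {subset An i <= An j}.
  elim: j => [|j IH]; first by rewrite leqn0 => /eqP ->.
  rewrite leq_eqVlt => /orP [/eqP -> //|/IH s x /s]; exact: Asub.
suff [n An_n] : exists n, {subset A <= An n}.
  by exists (An n) => //; apply/(sclosed_strong m eG).
elim: A => [|x A [n IH]]; first by exists 0.
have [k xk] := Aall x; exists (maxn n k) => y; rewrite inE => /orP [/eqP ->|/IH].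
  by apply: Amono xk; rewrite leq_maxr.
by apply: Amono; rewrite leq_maxl.
Qed.

Lemma strong_nil : strong [::].
Proof.
case: HM => _ [_ [_ emb]].
have [|h [_ [_]]] := emb void (fun _ _ => false).
  split=> [|A]; first by split=> -[].
  by rewrite /delta; case: A => [|[]]; rewrite /nedges //= muln0.
move/(sclosed_strong m eG); apply: strong_eqi => x.
by case: (enum _) => // -[].
Qed.

Lemma delta2_ge0 A : (0 <= delta2 e m A)%R.
Proof.
have := strong_nil A; rewrite (delta2_eqi e m (B := [::])) => [|x].
  by apply: le_trans; rewrite /delta2 /ecount big_nil muln0.
by rewrite mem_cap asboolb.
Qed.

Section IndependentExtension.
Variables (A B D : seq V).
Hypotheses (sA : strong A) (sB : strong B) (sD : strong D).
Hypotheses (AB : {subset A <= B}) (AD : {subset A <= D}).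

(* The free amalgam: [true] tags the points of [D] outside [A]. *)
Definition amalg_rel : rel (bool * V) := fun p q =>
  e p.2 q.2 && [|| p.1 == q.1, ~~ p.1 && (p.2 \in A) | ~~ q.1 && (q.2 \in A)].

Definition amalg_pts : seq (bool * V) :=
  [seq (false, b) | b <- B] ++ [seq (true, d) | d <- D & d \notin A].

Lemma amalg_graph : graph_rel amalg_rel.
Proof.
split=> [[s x] [t y]|[s x]]; rewrite /amalg_rel /= ?(eG.2 x) // (eG.1 x y).
by congr (_ && _); rewrite eq_sym; congr (_ || _); rewrite orbC.
Qed.

Lemma mem_amalg s x :
  ((s, x) \in amalg_pts) = if s then (x \in D) && (x \notin A) else x \in B.
Proof.
rewrite mem_cat; case: s; apply/orP/idP.
- by case=> /mapP [d]; rewrite ?mem_filter => dD [] // ->; rewrite andbC.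
- by move=> /andP [xD xA]; right; apply: map_f; rewrite mem_filter xA.
- by case=> /mapP [d] dB [] // ->.
- by move=> xB; left; apply: map_f.
Qed.

(** No edge joins [D] minus [A] to [B] minus [A], so [delta2_cat3] becomes exact modularity over the
    common part [I]; strength of [A] then shows that adding either side to [I] does not lower the
    predimension. *)
Lemma amalg_le (S : seq (bool * V)) : {subset S <= amalg_pts} ->
  (delta2 amalg_rel m [seq p <- S | ~~ p.1] <= delta2 amalg_rel m S)%R /\
  (delta2 amalg_rel m [seq p <- S | p.1 || (p.2 \in A)]
     <= delta2 amalg_rel m S)%R.
Proof.
move=> SL; pose f := amalg_rel.
pose I := [seq p <- undup S | ~~ p.1 & p.2 \in A].
pose Tr := [seq p <- undup S | p.1].
pose Fa := [seq p <- undup S | ~~ p.1 & p.2 \notin A].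
have u : uniq (I ++ Tr ++ Fa).
  rewrite !cat_uniq !filter_uniq ?undup_uniq //= has_cat negb_or !andbT.
  apply/andP; split; first (apply/andP; split); apply/hasPn => -[[] x];
    by rewrite !mem_filter //= => /andP [/negbTE -> _].
have := delta2_cat3 m amalg_graph u.
rewrite [X in ((2 * X)%:Z)%R](_ : _ = 0); last first.
  rewrite /ecount big1_seq // => -[s x] /andP [_]; rewrite mem_filter => /andP [/= -> _].
  rewrite big1_seq // => -[t y] /andP [_]; rewrite mem_filter /amalg_rel /=.
  by case/andP => /andP [/negbTE -> /negbTE ->] _; rewrite !andbF.
have toV (L : seq (bool * V)) :
    {in L &, forall p q, f p q = e p.2 q.2} -> {in L &, injective snd} ->
    delta2 f m L = delta2 e m (map snd L).
  by move=> fe inj; rewrite (delta2_map m (e := f)) // => p q pL qL; rewrite fe.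
have capA L : {subset I <= L} -> {in L, forall p, p \in S} ->
    {in L &, forall p q, f p q = e p.2 q.2} ->
    {in L &, injective snd} -> {in L, forall p, p.2 \in A -> ~~ p.1} ->
    (delta2 f m I <= delta2 f m L)%R.
  move=> IL LS fe inj LA; rewrite (toV L) // (toV I); first last.
  - by move=> p q /IL pL /IL qL; apply: inj.
  - by move=> p q /IL pL /IL qL; apply: fe.
  have := sA (map snd L); congr (_ <= _)%R; apply: delta2_eqi => x.
  apply/capP/mapP.
    move=> [xA /mapP [p pL xp]]; exists p => //; rewrite mem_filter mem_undup LS //.
    by rewrite -xp xA LA // -xp.
  move=> [p pI ->]; split; last by apply/map_f/IL.
  by move: pI; rewrite mem_filter => /andP [/andP []].
have inS p : p \in S -> if p.1 then (p.2 \in D) && (p.2 \notin A) else p.2 \in B.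
  by case: p => s x /SL; rewrite mem_amalg.
have le1 : (delta2 f m I <= delta2 f m (I ++ Tr))%R.
  have memL p : p \in I ++ Tr -> [/\ p \in S, p.1 || (p.2 \in A) & p.2 \in A -> ~~ p.1].
    rewrite mem_cat !mem_filter !mem_undup => /orP [/andP [/andP [-> ->]]|/andP [p1]] pS.
      by rewrite pS orbT.
    by move: (inS p pS); rewrite p1 pS => /andP [_ /negbTE ->].
  apply: capA.
  - by move=> p pI; rewrite mem_cat pI.
  - by move=> p /memL [].
  - move=> p q /memL [_ p1 _] /memL [_ q1 _]; rewrite /f /amalg_rel.
    move: p1 q1; case: (p.1); case: (q.1); case: (p.2 \in A); case: (q.2 \in A);
      by rewrite //= ?andbT.
  - move=> [s x] [t y] /memL [/= _ p1 p2] /memL [/= _ q1 q2] xy; subst y.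
    move: p1 p2 q1 q2; case: s; case: t; case: (x \in A) => //= _ p2 _ q2.
      by have := p2 isT.
    by have := q2 isT.
  - by move=> p /memL [].
have le2 : (delta2 f m I <= delta2 f m (I ++ Fa))%R.
  have memL p : p \in I ++ Fa -> p \in S /\ ~~ p.1.
    by rewrite mem_cat !mem_filter !mem_undup => /orP [] /andP [/andP [-> _] ->].
  apply: capA.
  - by move=> p pI; rewrite mem_cat pI.
  - by move=> p /memL [].
  - move=> p q /memL [_ /negbTE p1] /memL [_ /negbTE q1].
    by rewrite /f /amalg_rel p1 q1 eqxx andbT.
  - by move=> [[] x] [[] y] /memL [_ //] _ /memL [_ //] _ /= ->.
  - by move=> p /memL [].
rewrite (delta2_eqi f m (A := I ++ Tr ++ Fa) (B := S)); last first.
  move=> [s x]; rewrite !mem_cat !mem_filter mem_undup /=.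
  by case: s; case: (x \in A); case: ((_, x) \in S).
have -> : delta2 f m [seq p <- S | ~~ p.1] = delta2 f m (I ++ Fa).
  apply: delta2_eqi => -[s x]; rewrite !mem_cat !mem_filter mem_undup /=.
  by case: s; case: (x \in A); case: ((_, x) \in S).
have -> : delta2 f m [seq p <- S | p.1 || (p.2 \in A)] = delta2 f m (I ++ Tr).
  apply: delta2_eqi => -[s x]; rewrite !mem_cat !mem_filter mem_undup /=.
  by case: s; case: (x \in A); case: ((_, x) \in S).
rewrite -/f; move: le1 le2; set a := delta2 f m (I ++ Tr); set b := delta2 f m (I ++ Fa); lia.
Qed.

(** The free amalgam of [B] and [D] over [A] belongs to the class, hence embeds strongly.
    Homogeneity provides [g1] and [g2] carrying [B] and [D] to their copies in it, and [g1^-1 g2]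
    moves [D] into free position over [B]. *)
Lemma independent_extension : exists g : aut,
  [/\ {in A, g =1 id},
      forall x, x \in D -> g x \in B -> x \in A,
      forall x y, x \in D -> x \notin A -> y \in B -> y \notin A -> ~~ e (g x) y &
      strong (B ++ map g D)].
Proof.
pose f := amalg_rel; pose L := amalg_pts.
pose W := seq_sub L; pose fW : rel W := fun p q => f (val p) (val q).
have fWG : graph_rel fW.
  by split=> [p q|p]; [exact: amalg_graph.1|exact: amalg_graph.2].
have valE (S : seq W) : delta2 fW m S = delta2 f m (map val S).
  by rewrite (delta2_map m (e := fW) (f := val)) // => p q _ _; apply: val_inj.
have toB (S : seq (bool * V)) : {subset S <= L} -> (0 <= delta2 f m S)%R.
  move=> SL; apply: le_trans (amalg_le SL).1.
  rewrite -(delta2_map m (f := snd) (e' := e)); first exact: delta2_ge0.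
    by move=> [[] x] [[] y] /=; rewrite !mem_filter //= => _ _ ->.
  move=> p q; rewrite !mem_filter /f /amalg_rel => /andP [/negbTE -> _].
  by move=> /andP [/negbTE -> _]; rewrite andbT.
have [|h [hinj [he /(sclosed_strong m eG) hs]]] := HM.2.2.2 W fW.
  split=> // S; have -> : (0 = delta fW m [::])%R.
    by rewrite /delta /nedges /= muln0.
  rewrite delta_le // [X in (X <= _)%R](_ : _ = 0%R); last first.
    by rewrite /delta2 /ecount big_nil muln0.
  by rewrite valE; apply: toB => _ /mapP [p _ ->]; apply: valP.

pose h' (p : bool * V) : V := oapp h p.2 (insub p).
have h'E p (pL : p \in L) : h' p = h (Sub p pL : W) by rewrite /h' insubT.
have h'inj : {in L &, injective h'}.
  by move=> p q pL qL; rewrite !h'E => /hinj /(congr1 val).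
have h'e : {in L &, forall p q, e (h' p) (h' q) = f p q}.
  by move=> p q pL qL; rewrite !h'E he.
have h's : strong (map h' L).
  apply: strong_eqi hs => x; apply/mapP/mapP => -[p pL ->].
    exists (val p); first exact: valP.
    by rewrite h'E; [exact: valP|move=> ?; congr h; apply: val_inj].
  by exists (Sub p pL : W); rewrite ?mem_enum ?h'E.
(* A finite set of vertices is cut down to the copy of the amalgam, which is strong, and pulled back
   to the tagged points, where the inequality [PL] applies. *)
have sub_strong (P : pred (bool * V)) :
    (forall S, {subset S <= L} -> (delta2 f m [seq p <- S | P p] <= delta2 f m S)%R) ->
    strong (map h' [seq p <- L | P p]).
  move=> PL T; apply: le_trans (h's T).
  pose S := [seq p <- L | h' p \in T].
  have SL : {subset S <= L} by move=> p; rewrite mem_filter => /andP [].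
  have mapS (S' : seq (bool * V)) : {subset S' <= L} -> delta2 e m (map h' S') = delta2 f m S'.
    move=> S'L; apply: delta2_map => p q /S'L pL /S'L qL; first exact: h'inj.
    exact: h'e.
  have := PL S SL; rewrite -!mapS //; last by move=> p; rewrite mem_filter => /andP [_ /SL].
  congr (_ <= _)%R; apply: delta2_eqi => x; apply/mapP/capP.
  - move=> [p]; rewrite !mem_filter => /and3P [Pp hT pL] ->; split=> //.
    by apply: map_f; rewrite mem_filter Pp.
  - move=> [/mapP [p]]; rewrite mem_filter => /andP [Pp pL] -> hT.
    by exists p => //; rewrite !mem_filter Pp hT.
  - by move=> [p]; rewrite !mem_filter => /andP [hT pL] ->; split=> //; apply: map_f.
  - by move=> [/mapP [p pL ->] hT]; exists p => //; rewrite !mem_filter hT.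
have LB b : b \in B -> (false, b) \in L by rewrite mem_amalg.
have LD d : d \in D -> (d \notin A, d) \in L.
  by move=> dD; rewrite mem_amalg dD; case dA: (d \in A) => //=; apply: AB.
have [|||g1 g1E] := homogeneity (A := B) (f := fun b => h' (false, b)) sB.
- apply: strong_eqi (sub_strong (fun p => ~~ p.1) _); last by move=> S /amalg_le [].
  move=> x; apply/mapP/mapP => [[[[] b]]|[b bB ->]].
  + by rewrite mem_filter.
  + by rewrite mem_filter mem_amalg => /= bB ->; exists b.
  + by exists (false, b); rewrite ?mem_filter ?mem_amalg.
- by move=> x y xB yB /(h'inj _ _ (LB _ xB) (LB _ yB)) [].
- by move=> x y xB yB /=; rewrite h'e ?LB // /f /amalg_rel /= andbT.
have [|||g2 g2E] := homogeneity (A := D) (f := fun d => h' (d \notin A, d)) sD.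
- apply: strong_eqi (sub_strong (fun p => p.1 || (p.2 \in A)) _); last by move=> S /amalg_le [].
  move=> x; apply/mapP/mapP => [[[s d]]|[d dD ->]].
  + rewrite mem_filter mem_amalg /= => dL ->; exists d.
      by case: s dL => /=; [case/andP|case/andP=> /AD].
    by case: s dL => /=; [case/andP=> _ ->|case/andP=> ->].
  + exists (d \notin A, d) => //; rewrite mem_filter LD //=.
    by case: (d \in A).
- by move=> x y xD yD /(h'inj _ _ (LD _ xD) (LD _ yD)) [].
- move=> x y xD yD /=; rewrite h'e ?LD // /f /amalg_rel /=.
  by case: (x \in A); case: (y \in A); rewrite /= ?orbT ?andbT.
exists (acomp (ainv g1) g2); split=> /=.
- by move=> a aA; rewrite g2E ?AD // aA -(g1E a) ?AB // afK.
- move=> x xD; set b := ab g1 _ => bB; have : g1 b = g2 x by rewrite /b abK.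
  rewrite g1E // g2E // => /(h'inj _ _ (LB _ bB) (LD _ xD)) [].
  by case: (x \in A).
- move=> x y xD xA yB yA; rewrite -(af_edge g1) abK g2E // g1E // h'e ?LD ?LB //.
  by rewrite /f /amalg_rel /= xA (negbTE yA) andbF.
- apply: strong_eqi (strong_map (ainv g1) h's) => x.
  rewrite mem_map_autV /= mem_cat; apply/mapP/orP => [[[s y]]|].
    rewrite mem_amalg => yL g1x; case: s yL g1x => [/andP [yD yA]|yB] g1x.
      right; apply/mapP; exists y => //=.
      by rewrite g2E // yA -g1x afK.
    by left; move: g1x; rewrite -g1E // => /af_inj ->.
  case=> [xB|/mapP [d dD ->]].
    by exists (false, x); rewrite ?mem_amalg ?g1E.
  by exists (d \notin A, d); rewrite ?LD //= abK g2E.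
Qed.

End IndependentExtension.
End Generic.

(** * Free extensions of a group action *)

(** Graphs on which the free group on [I] acts by automorphisms, the targets of the universal
    property [free_over]. The edge relation is arbitrary, which makes room for the ad hoc targets
    used in the proofs below. *)
Record fgraph (I : Type) := FGraph {
  fsort :> Type;
  fedge : fsort -> fsort -> Prop;
  fmap : I -> fsort -> fsort;
  fmapV : I -> fsort -> fsort;
  fmapK : forall i, cancel (fmap i) (fmapV i);
  fmapVK : forall i, cancel (fmapV i) (fmap i);
  fmap_edge : forall i x y, fedge x y -> fedge (fmap i x) (fmap i y);
  fmapV_edge : forall i x y, fedge x y -> fedge (fmapV i x) (fmapV i y) }.

(** Unreduced words, [true] marking a generator and [false] its inverse; only their action matters,
    so no normal form is needed. *)
Definition word (I : Type) := seq (I * bool).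

Section Words.
Variables (I : Type) (N : fgraph I).

Definition letter (p : I * bool) : N -> N :=
  if p.2 then fmap (f := N) p.1 else fmapV (f := N) p.1.

Definition act (w : word I) (x : N) : N := foldr letter x w.

Definition winv (w : word I) : word I := rev [seq (p.1, ~~ p.2) | p <- w].

Lemma act_cat w w' x : act (w ++ w') x = act w (act w' x).
Proof. exact: foldr_cat. Qed.

Lemma letterK p : cancel (letter p) (letter (p.1, ~~ p.2)).
Proof. by case: p => i [] x; rewrite /letter /= ?fmapK ?fmapVK. Qed.

Lemma actK w : cancel (act w) (act (winv w)).
Proof.
elim: w => [|p w IH] x //.
by rewrite /winv /= rev_cons -cats1 act_cat /= letterK IH.
Qed.

Lemma winvK w : winv (winv w) = w.
Proof.
rewrite /winv map_rev revK -map_comp (@eq_map _ _ _ id) ?map_id // => -[i b] /=.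
by rewrite negbK.
Qed.

Lemma actVK w : cancel (act (winv w)) (act w).
Proof. by rewrite -{2}(winvK w); apply: actK. Qed.

Lemma act_edge w x y : fedge x y -> fedge (act w x) (act w y).
Proof.
move=> exy; elim: w => [|[i []] w IH] //=; rewrite /letter /=.
  exact: fmap_edge.
exact: fmapV_edge.
Qed.

End Words.

(* [None] is a fixed point adjacent to everything, so sending part of a graph to it imposes
   no condition there. *)
Definition fgraph_option (I : Type) (N : fgraph I) : fgraph I.
Proof.
refine (@FGraph I (option N)
  (fun a b => if a is Some x then if b is Some y then fedge x y else True else True)
  (fun i => omap (fmap (f := N) i)) (fun i => omap (fmapV (f := N) i)) _ _ _ _).
- by move=> i [x|] //=; rewrite fmapK.
- by move=> i [x|] //=; rewrite fmapVK.
- by move=> i [x|] [y|] //=; apply: fmap_edge.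
- by move=> i [x|] [y|] //=; apply: fmapV_edge.
Defined.

Lemma act_option (I : Type) (N : fgraph I) w (x : N) :
  act (N := fgraph_option N) w (Some x) = Some (act w x).
Proof. by elim: w => [|[i []] w IH] //=; rewrite IH. Qed.

Section FreeSteps.
Variables (m : nat) (V : countType) (e : rel V).
Hypothesis HM : is_generic m e.
Local Notation strong := (strong e m).
Local Notation aut := (aut e).
Local Notation delta2 := (delta2 e m).
Let eG : graph_rel e := HM.1.
Implicit Types (Z S : V -> Prop) (D A T : seq V).

Section Action.
Variables (I : Type) (u : I -> aut).

Definition fgraphV : fgraph I.
Proof.
refine (@FGraph I V (fun x y => e x y) (fun i => u i) (fun i => ab (u i)) _ _ _ _).
- by move=> i; apply: afK.
- by move=> i; apply: abK.
- by move=> i x y; rewrite af_edge.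
- by move=> i x y; rewrite ab_edge.
Defined.

Local Notation actV w := (act (N := fgraphV) w).

Lemma act_aut_edge w x y : e (actV w x) (actV w y) = e x y.
Proof.
apply/idP/idP => [exy|]; last exact: (act_edge (N := fgraphV)).
by rewrite -(actK (N := fgraphV) w x) -(actK (N := fgraphV) w y);
  apply: (act_edge (N := fgraphV)).
Qed.

Definition act_aut (w : word I) : aut :=
  Aut (actK (N := fgraphV) w) (actVK (N := fgraphV) w) (act_aut_edge w).

Definition uclosed Z := forall i x, Z (u i x) <-> Z x.
Definition clos Z : V -> Prop := fun x => exists w p, Z p /\ x = actV w p.
Definition eqvar (N : fgraph I) Z (f : V -> N) :=
  forall i x, Z x -> f (u i x) = fmap i (f x).
Definition homo (J : Type) (N : fgraph J) Z (f : V -> N) :=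
  forall x y, Z x -> Z y -> e x y -> fedge (f x) (f y).

Lemma closed_act Z w x : uclosed Z -> Z (actV w x) <-> Z x.
Proof.
move=> cZ; elim: w => [|[i []] w IH] //=; rewrite -IH /letter /=; first exact: cZ.
by rewrite -{2}(abK (u i) (actV w x)); split=> /cZ.
Qed.

Lemma clos_uclosed Z : uclosed (clos Z).
Proof.
move=> i x; split=> -[w [p [Zp E]]].
  exists ((i, false) :: w), p; split=> //.
  by rewrite /= -E /letter /= afK.
by exists ((i, true) :: w), p; split=> //; rewrite /= -E.
Qed.

Lemma sub_clos Z x : Z x -> clos Z x.
Proof. by move=> Zx; exists [::], x. Qed.

Lemma clos_min Z Z' : uclosed Z' -> (forall x, Z x -> Z' x) -> forall x, clos Z x -> Z' x.
Proof. by move=> cZ' ZZ' x [w [p [Zp ->]]]; apply/closed_act => //; apply: ZZ'. Qed.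

Lemma clos_id Z : uclosed Z -> clos Z = Z.
Proof.
move=> cZ; apply/predeqP => x; split; last exact: sub_clos.
exact: clos_min.
Qed.

Lemma eqvar_act (N : fgraph I) Z (f : V -> N) w x : uclosed Z -> eqvar Z f -> Z x ->
  f (actV w x) = act w (f x).
Proof.
move=> cZ ef Zx; elim: w => [|[i b] w IH] //=.
have Zw : Z (actV w x) by apply/closed_act.
rewrite -IH /letter; case: b => /=; first exact: ef.
have Zv : Z (ab (u i) (actV w x)) by apply/(cZ i); rewrite abK.
by rewrite -[in RHS](abK (u i) (actV w x)) ef // fmapK.
Qed.

Lemma eqvar_unique (N : fgraph I) Z (f f' : V -> N) :
  eqvar (clos Z) f -> eqvar (clos Z) f' -> (forall x, Z x -> f x = f' x) ->
  forall x, clos Z x -> f x = f' x.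
Proof.
move=> ef ef' E x [w [p [Zp ->]]]; have cp := sub_clos Zp.
by rewrite !(eqvar_act _ (@clos_uclosed Z)) // E.
Qed.

Lemma eqvar_sub (N : fgraph I) Z Z' (f : V -> N) :
  (forall x, Z x -> Z' x) -> eqvar Z' f -> eqvar Z f.
Proof. by move=> ZZ' ef i x /ZZ' /ef. Qed.

(** Universal property of a free amalgam: the closure of [Z] and [D] arises from [Z] by attaching
    freely moving translates of [D] along the translates of the common part. Uniqueness of [g] on
    this closure is [eqvar_unique]. *)
Definition free_over Z D := forall (N : fgraph I) (f : V -> N),
  eqvar Z f -> homo Z f -> homo (fun x => x \in D) f ->
  exists g : V -> N, [/\ forall x, Z x \/ x \in D -> g x = f x,
    eqvar (clos (fun x => Z x \/ x \in D)) g &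
    homo (clos (fun x => Z x \/ x \in D)) g].

Record free_step Z D : Prop := FreeStep {
  fs_uclosed : uclosed Z;
  fs_strong : strong D;
  fs_base : strong (cap D Z);
  fs_free : free_over Z D }.

Definition ext Z D := clos (fun x => Z x \/ x \in D).

Lemma ext_closed Z D : uclosed (ext Z D). Proof. exact: clos_uclosed. Qed.
Lemma ext_l Z D x : Z x -> ext Z D x. Proof. by move=> Zx; apply: sub_clos; left. Qed.
Lemma ext_r Z D x : x \in D -> ext Z D x. Proof. by move=> xD; apply: sub_clos; right. Qed.

Lemma ext_min Z Z' D : uclosed Z' -> (forall x, Z x -> Z' x) -> (forall x, x \in D -> Z' x) ->
  forall x, ext Z D x -> Z' x.
Proof. by move=> cZ' ZZ' DZ'; apply: clos_min => // x [/ZZ'|/DZ']. Qed.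

(* The target [option (V -> V)], with the group acting by postcomposition, records which
   translate of [D] a point lies in. *)
Lemma free_step_stab Z D w d : free_step Z D -> d \in D -> ~ Z d ->
  actV w d \in D -> actV w =1 id.
Proof.
move=> [cZ _ _ free] dD nZd wdD.
pose NF : fgraph I := @FGraph I (V -> V) (fun _ _ => True)
  (fun i f => u i \o f) (fun i f => ab (u i) \o f)
  (fun i f => funext (fun x => afK (u i) (f x)))
  (fun i f => funext (fun x => abK (u i) (f x)))
  (fun _ _ _ _ => Logic.I) (fun _ _ _ _ => Logic.I).
pose f (x : V) : fgraph_option NF := if `[< Z x >] then None else Some id.
have [|||g [gf eg _]] := free _ f.
- move=> i x Zx; rewrite /f asboolT; last exact/cZ.
  by rewrite asboolT.
- by move=> x y _ _ _; rewrite /f; case: ifP => //; case: ifP.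
- by move=> x y _ _ _; rewrite /f; case: ifP => //; case: ifP.
have fE x : x \in D -> ~ Z x -> g x = Some id.
  by move=> xD nZx; rewrite gf; [rewrite /f asboolF|right].
have nZwd : ~ Z (actV w d) by move/(closed_act w d cZ).
have := eqvar_act w (@clos_uclosed _) eg (sub_clos (or_intror dD)).
rewrite !fE // act_option => -[E] x.
have actNF w' : act (N := NF) w' id x = actV w' x.
  by elim: w' => [|[i []] w' IH] //=; rewrite -IH.
by rewrite -actNF -E.
Qed.

(** The target is [V] in which two points are related when both lie in [Z] or in a common translate
    of [D]. Freeness makes the identity a homomorphism into it, so every edge of the extension is
    such a pair; by [free_step_stab] a translate of [D] through [d] is [D] itself. *)
Lemma free_step_edge Z D d y : free_step Z D -> d \in D -> ~ Z d -> ext Z D y -> e d y ->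
  y \in D.
Proof.
move=> fs dD nZd Zy edy; have [cZ _ _ free] := fs.
pose E (x y : V) : Prop := (Z x /\ Z y) \/ exists w, actV w x \in D /\ actV w y \in D.
have EU i x z : E x z -> E (u i x) (u i z).
  case=> [[Zx Zz]|[w [wx wz]]]; first by left; split; apply/cZ.
  right; exists (w ++ [:: (i, false)]); rewrite !act_cat /letter /= /letter /=.
  by rewrite !afK.
have EV i x z : E x z -> E (ab (u i) x) (ab (u i) z).
  case=> [[Zx Zz]|[w [wx wz]]]; first by left; split; apply/(cZ i); rewrite abK.
  right; exists (w ++ [:: (i, true)]); rewrite !act_cat /letter /= /letter /=.
  by rewrite !abK.
pose NE : fgraph I := @FGraph I V E (fun i => u i) (fun i => ab (u i))
  (fun i => afK (u i)) (fun i => abK (u i)) EU EV.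
have [|||g [gf eg hg]] := free NE id.
- by [].
- by move=> x z Zx Zz _; left.
- by move=> x z xD zD _; right; exists [::].
have gid x : ext Z D x -> g x = x.
  move: x; apply: (eqvar_unique (N := NE) (f' := id)) => //.
have := hg d y (ext_r Z dD) Zy edy.
rewrite !gid //; last exact: ext_r.
case=> [[]//|[w [wd wy]]]; have wid := free_step_stab fs dD nZd wd.
by move: wy; rewrite wid.
Qed.

(** Induction on the number of points of [T] outside [Z]. Such a point lies in a translate of [D];
    moved back by that word, the points of [T] in [D] outside [Z] have their other neighbours in the
    strong set [cap D Z] by [free_step_edge], so [delta2_peel] removes them. *)
Lemma free_step_rel_strong Z D T : free_step Z D -> (forall x, x \in T -> ext Z D x) ->
  (delta2 (cap T Z) <= delta2 T)%R.
Proof.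
move=> fs; have [cZ _ sA _] := fs.
have [n] := ubnP (size [seq x <- T | ~~ `[< Z x >]]); elim: n T => // n IH T ltn TZ.
case E: [seq x <- T | ~~ `[< Z x >]] => [|x s].
  rewrite (delta2_eqi e m (B := T)) // => x; rewrite mem_cap andbC.
  case xT: (x \in T) => //=; apply/negPn/negP => nZx.
  by have : x \in [seq x <- T | ~~ `[< Z x >]]; [rewrite mem_filter nZx|rewrite E].
have : x \in [seq x <- T | ~~ `[< Z x >]] by rewrite E mem_head.
rewrite mem_filter => /andP [/asboolPn nZx xT].
have [w [d [Zd xE]]] := TZ x xT.
have nZd : ~ Z d by move=> Zd'; apply: nZx; rewrite xE; apply/closed_act.
have dD : d \in D by case: Zd.
pose f := act_aut w; pose P : pred V := fun y => (y \in D) && ~~ `[< Z y >].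
pose T' := [seq y <- T | ~~ P (ab f y)].
have mapf (S : seq V) : delta2 (map (ab f) S) = delta2 S.
  apply: delta2_map => [y z _ _|y z _ _]; last exact: ab_edge.
  exact: can_inj (abK f) _ _.
have le1 : (delta2 T' <= delta2 T)%R.
  rewrite -(mapf T') -(mapf T).
  have -> : map (ab f) T' = [seq y <- map (ab f) T | ~~ P y] by rewrite filter_map.
  apply: (delta2_peel eG sA) => [y _ /andP [_ nZy]|y z _ /andP [yD /asboolPn nZy]].
    by rewrite mem_cap negb_and nZy.
  move=> /mapP [t tT ->] nP eyz; have zD : ab f t \in D.
    apply: free_step_edge fs yD nZy _ eyz.
    by apply/(closed_act _ _ (@ext_closed Z D)); exact: TZ.
  by rewrite mem_cap zD andbT; move: nP; rewrite /P zD /= negbK.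
apply: le_trans le1; rewrite (delta2_eqi e m (B := cap T' Z)).
  apply: IH => [|y]; last by rewrite mem_filter => /andP [_ /TZ].
  rewrite ltnS in ltn; apply: leq_trans ltn.
  rewrite /T' -filter_predI !size_filter !(permP (perm_to_rem xT)) /= (asboolF nZx).
  have -> : P (ab f x) by rewrite xE /= (actK (N := fgraphV)) /P dD (asboolF nZd).
  by rewrite /= add0n add1n ltnS; apply: sub_count => y /andP [].
move=> y; rewrite !mem_cap mem_filter andbA; congr (_ && _).
case: asboolP => //= Zy; rewrite /P (_ : `[< Z _ >] = true) ?andbF //.
by apply/asboolP/(closed_act (winv w) y cZ).
Qed.

End Action.
End FreeSteps.

(** * Good sets: bases over which the action is generated freely and richly *)

Section GoodSets.
Variables (m : nat) (V : countType) (e : rel V).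
Hypothesis HM : is_generic m e.
Local Notation strong := (strong e m).
Local Notation Str := (Str e m).
Local Notation aut := (aut e).
Local Notation delta2 := (delta2 e m).
Implicit Types (Z S : V -> Prop) (D A B T G : seq V).

Variables (I : Type) (u : I -> aut).
Local Notation free_step := (free_step m u).

(** Sending the points of [S1] outside [S] to [None] turns a map over [S] into one over [S1]. Its
    extension avoids [None] on what [S] and [D] generate. *)
Lemma free_step_sub S S1 D : uclosed u S -> (forall x, S x -> S1 x) ->
  (forall x, x \in D -> S1 x -> S x) -> free_step S1 D -> free_step S D.
Proof.
move=> cS SS1 DS [cS1 sD sA free]; split=> //.
  apply: strong_eqi sA => x; apply/capP/capP => -[Sx xD]; split=> //; [exact: DS|exact: SS1].
move=> N f ef hS hD; pose f' (x : V) : fgraph_option N :=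
  if `[< S x \/ ~ S1 x >] then Some (f x) else None.
have f'S x : S x -> f' x = Some (f x) by move=> Sx; rewrite /f' asboolT //; left.
have f'D x : x \in D -> f' x = Some (f x).
  by move=> xD; rewrite /f' asboolT //; case: (pselect (S1 x)) => [/DS|]; [left; auto|right].
have f'N x : S1 x -> ~ S x -> f' x = None.
  by move=> S1x nSx; rewrite /f' asboolF // => -[].
have [|||g [gf eg hg]] := free _ f'.
- move=> i x S1x; case: (pselect (S x)) => Sx.
    by rewrite !f'S ?ef //; apply/cS.
  by rewrite !f'N //; [apply/cS1|move/(cS i x)].
- move=> x y S1x S1y exy; rewrite /f'; case: asboolP => // Sx; case: asboolP => // Sy /=.
  by apply: hS => //; [case: Sx|case: Sy].
- by move=> x y xD yD exy; rewrite !f'D //=; apply: hD.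
have sub x : ext u S D x -> ext u S1 D x.
  apply: ext_min => [|y /SS1|y]; [exact: ext_closed|exact: ext_l|exact: ext_r].
have gS x : ext u S D x -> exists y, g x = Some y.
  case=> w [p [Sp ->]]; have p1 : ext u S1 D p.
    by apply: sub; apply: sub_clos.
  exists (act w (f p)).
  rewrite (eqvar_act w (@ext_closed _ _ _ _ _ _) eg) // gf; last by case: Sp => [/SS1|]; auto.
  by case: Sp => [/f'S|/f'D] ->; rewrite act_option.
exists (fun x => odflt (f x) (g x)); split=> [x Sx|i x Sx|x y Sx Sy exy].
- rewrite gf; last by case: Sx => [/SS1|]; auto.
  by case: Sx => [/f'S|/f'D] ->.
- by have [y gx] := gS x Sx; rewrite eg ?gx //; apply: sub.
- have [[x' gx] [y' gy]] := (gS x Sx, gS y Sy).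
  by have := hg x y (sub x Sx) (sub y Sy) exy; rewrite gx gy.
Qed.

Lemma ext_ext S D D' :
  ext u (ext u S D) D' = clos u (fun x => S x \/ x \in D ++ D').
Proof.
apply/predeqP => x; split; move: x.
  apply: ext_min; first exact: clos_uclosed; last first.
    by move=> x xD; apply: sub_clos; rewrite mem_cat xD orbT; right.
  apply: ext_min; [exact: clos_uclosed|by move=> x Sx; apply: sub_clos; left|].
  by move=> x xD; apply: sub_clos; right; rewrite mem_cat xD.
apply: clos_min; first exact: clos_uclosed.
move=> x [Sx|]; first by do 2 apply: ext_l.
by rewrite mem_cat => /orP [xD|xD]; [apply/ext_l/ext_r|apply: ext_r].
Qed.

Lemma ext_swap S D D' : ext u (ext u S D) D' = ext u (ext u S D') D.
Proof.
rewrite !ext_ext; congr (clos u _); apply/predeqP => x.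
by rewrite !mem_cat orbC.
Qed.

(** A map on [ext u S D'] and [D] is first extended from [S] and [D] by the first step, then by the
    second step with its prescribed values on [D']. By uniqueness of equivariant maps the result
    agrees with the given one on all of [ext u S D']. *)
Lemma free_step_swap S D D' : free_step S D -> free_step (ext u S D) D' ->
  (forall x, x \in D' -> ext u S D x -> S x) -> free_step (ext u S D') D.
Proof.
move=> [cS sD sA free] [_ sD' sA' free'] D'S; split=> //.
- exact: ext_closed.
- apply: strong_eqi sA => x; apply/capP/capP => -[Sx xD]; split=> //; first exact: ext_l.
  case: Sx => w [p [Sp E]]; rewrite E; apply/closed_act => //; case: Sp => // pD'.
  apply: D'S => //; apply/(closed_act w p (@ext_closed _ _ _ _ S D)).
  by rewrite -E; apply: ext_r.
move=> N f ef hS hD.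
have [|||g [gf eg hg]] := free _ f => //.
- by apply: eqvar_sub ef => x; apply: ext_l.
- by move=> x y Sx Sy; apply: hS; apply: ext_l.
pose f' x := if `[< ext u S D x >] then g x else f x.
have f'1 x : ext u S D x -> f' x = g x by move=> Sx; rewrite /f' asboolT.
have f'2 x : x \in D' -> f' x = f x.
  move=> xD'; rewrite /f'; case: asboolP => // Sx; apply: gf; left; exact: D'S.
have [|||h [hf eh hh]] := free' _ f'.
- move=> i x Sx; rewrite !f'1 ?eg //; exact/ext_closed.
- by move=> x y Sx Sy exy; rewrite !f'1 //; apply: hg.
- move=> x y xD yD exy; rewrite !f'2 //; apply: hS => //; exact: ext_r.
have hSD : forall x, S x \/ x \in D -> h x = f x.
  by move=> x Sx; rewrite hf ?f'1 ?gf //; [apply: sub_clos|left; apply: sub_clos].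
have hD' x : x \in D' -> h x = f x.
  by move=> xD'; rewrite hf ?f'2 //; right.
have sub x : ext u S D' x -> ext u (ext u S D) D' x.
  by apply: ext_min => [|y Sy|y]; [exact: ext_closed|do 2 apply: ext_l|exact: ext_r].
exists h; split=> [x|i x|x y]; last 2 first.
- by move=> Sx; apply: eh; move: Sx; rewrite -/(ext u _ D) -ext_swap.
- by move=> Sx Sy exy; apply: hh => //; [move: Sx|move: Sy]; rewrite -/(ext u _ D) -ext_swap.
case=> [Sx|xD]; last by apply: hSD; right.
move: x Sx; apply: eqvar_unique => [|//|x [Sx|]]; last exact: hD'.
  by apply: eqvar_sub eh.
by apply: hSD; left.
Qed.

Inductive steps : (V -> Prop) -> (V -> Prop) -> Prop :=
| steps_refl Z : steps Z Z
| steps_cons Z D Z' : free_step Z D -> steps (ext u Z D) Z' -> steps Z Z'.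

Lemma steps_one Z D : free_step Z D -> steps Z (ext u Z D).
Proof. by move=> fs; apply: steps_cons fs (steps_refl _). Qed.

Lemma steps_trans Z Z1 Z2 : steps Z Z1 -> steps Z1 Z2 -> steps Z Z2.
Proof. by elim=> // Z3 D Z4 fs _ IH /IH; apply: steps_cons. Qed.

Lemma steps_sub Z Z' x : steps Z Z' -> Z x -> Z' x.
Proof. by move=> s; elim: s x => // Z1 D Z2 fs _ IH x Zx; apply/IH/ext_l. Qed.

Lemma steps_closed Z Z' : steps Z Z' -> uclosed u Z -> uclosed u Z'.
Proof. by elim=> // Z1 D Z2 _ _ IH _; apply/IH/ext_closed. Qed.

Lemma steps_rel_strong Z Z' T : steps Z Z' -> (forall x, x \in T -> Z' x) ->
  (delta2 (cap T Z) <= delta2 T)%R.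
Proof.
move=> s; elim: s T => {Z Z'} [Z T TZ|Z D Z' fs s IH T TZ'].
  rewrite (delta2_eqi e m (B := T)) // => x; rewrite mem_cap andbC.
  by case xT: (x \in T) => //=; apply/asboolP/TZ.
apply: le_trans (IH T TZ'); rewrite (delta2_eqi e m (B := cap (cap T (ext u Z D)) Z)).
  by apply: (free_step_rel_strong HM fs) => x /capP [].
move=> x; apply/capP/capP => -[Zx]; last by move/capP => [].
by move=> xT; split=> //; apply/capP; split=> //; apply: ext_l.
Qed.

(** [free_step_swap] carries [D] to the front of the chain past one step at a time, and
    [free_step_sub] lowers its base to [S]. *)
Lemma steps_swap S S1 D : uclosed u S -> steps S S1 -> free_step S1 D ->
  (forall x, x \in D -> S1 x -> S x) ->
  free_step S D /\ steps (ext u S D) (ext u S1 D).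
Proof.
move=> cS s; elim: s cS => {S S1} [S cS fs _|S D1 S1 fs1 s IH cS fs DS].
  by split=> //; apply: steps_refl.
have [||fs' s'] := IH _ fs.
- exact: ext_closed.
- by move=> x xD /(DS x xD); apply: ext_l.
have DS' x : x \in D -> ext u S D1 x -> S x.
  by move=> xD /(steps_sub s); apply: DS.
split; first by apply: free_step_sub fs' => // x; apply: ext_l.
apply: steps_cons (free_step_swap fs1 fs' DS') _.
by rewrite -ext_swap.
Qed.

(** Besides exhausting [V], the chain solves every extension problem of finite strong sets over each
    stage: at some later stage a free copy of [D] is added first, and the rest of that stage is
    built over it. *)
Definition rich_chain (W : nat -> V -> Prop) :=
  [/\ forall k, steps (W k) (W k.+1), forall x, exists k, W k x &
    forall k A D, strong A -> strong D -> {subset A <= D} ->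
      (forall x, x \in A -> W k x) ->
      exists j (g : aut), [/\ k <= j, {in A, g =1 id}, free_step (W j) (map g D),
        forall x, x \in D -> W j (g x) -> x \in A &
        steps (ext u (W j) (map g D)) (W j.+1)]].

(** The initial [steps Z (W 0)] absorbs the steps that are left over when a solved problem has been
    moved to the front, as in [good_ext]. *)
Definition good Z := uclosed u Z /\ exists2 W, rich_chain W & steps Z (W 0).

Lemma chain_steps (W : nat -> V -> Prop) i j :
  (forall k, steps (W k) (W k.+1)) -> i <= j -> steps (W i) (W j).
Proof.
move=> sW; elim: j => [|j IH]; first by rewrite leqn0 => /eqP ->; apply: steps_refl.
rewrite leq_eqVlt => /orP [/eqP ->|/IH s]; first exact: steps_refl.
exact: steps_trans s (sW j).
Qed.

Lemma rich_chain_shift W n : rich_chain W -> rich_chain (fun k => W (n + k)).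
Proof.
case=> sW WV rW; split=> [k|x|k A D sA sD AD AW]; first by rewrite addnS.
  have [k Wx] := WV x; exists k; apply: steps_sub Wx.
  by apply: chain_steps => //; apply: leq_addl.
have [j [g [kj gA fs gD s]]] := rW (n + k) A D sA sD AD AW.
exists (j - n), g; rewrite addnS subnKC; last exact: leq_trans (leq_addr _ _) kj.
by split=> //; rewrite leq_subRL // (leq_trans (leq_addr _ _) kj).
Qed.

Lemma chain_finite (W : nat -> V -> Prop) B : (forall k, steps (W k) (W k.+1)) ->
  (forall x, exists k, W k x) -> exists k, forall x, x \in B -> W k x.
Proof.
move=> sW WV; elim: B => [|x B [k IH]]; first by exists 0.
have [l Wx] := WV x; exists (maxn k l) => y; rewrite inE => /orP [/eqP ->|/IH Wy].
  exact: steps_sub (chain_steps sW (leq_maxr k l)) Wx.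
exact: steps_sub (chain_steps sW (leq_maxl k l)) Wy.
Qed.

Lemma good_reach Z B : good Z ->
  exists Z', [/\ steps Z Z', good Z' & forall x, x \in B -> Z' x].
Proof.
case=> cZ [W rW s0]; have [sW WV _] := rW.
have [k BW] := chain_finite B sW WV; exists (W k).
have s : steps Z (W k) by apply: steps_trans s0 (chain_steps sW _).
split=> //; split; first exact: steps_closed s cZ.
exists (fun j => W (k + j)); first exact: rich_chain_shift.
by rewrite addn0; apply: steps_refl.
Qed.

(** Richness solves the problem over some late stage [W j]; [steps_swap] moves the free copy down to
    [Z] and turns the steps before that stage into steps over the enlarged set. *)
Lemma good_ext Z A D : good Z -> strong A -> strong D -> {subset A <= D} ->
  (forall x, x \in A -> Z x) ->
  exists g : aut, [/\ {in A, g =1 id}, free_step Z (map g D),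
    forall x, x \in D -> Z (g x) -> x \in A & good (ext u Z (map g D))].
Proof.
case=> cZ [W rW s0] sA sD AD AZ; have [sW _ rich] := rW.
have [|j [g [_ gA fs gD s]]] := rich 0 A D sA sD AD.
  by move=> x /AZ; apply: steps_sub.
have sj : steps Z (W j) by apply: steps_trans s0 (chain_steps sW _).
have [|fs' s'] := steps_swap cZ sj fs.
  by move=> _ /mapP [x xD ->] /(gD x xD) xA; rewrite gA //; apply: AZ.
exists g; split=> //; first by move=> x xD /(steps_sub sj); apply: gD.
split; first exact: ext_closed.
exists (fun k => W (j.+1 + k)); first exact: rich_chain_shift.
by rewrite addn0; apply: steps_trans s' s.
Qed.

Lemma steps_good_Str Z Z' : steps Z Z' -> good Z' -> Str Z.
Proof.
move=> s gZ' T; have [Z1 [s1 _ TZ1]] := good_reach T gZ'.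
by apply: steps_rel_strong TZ1; apply: steps_trans s s1.
Qed.

Lemma good_Str Z : good Z -> Str Z.
Proof. exact/steps_good_Str/steps_refl. Qed.

Definition fingen Z := exists G, Z = clos u (fun x => x \in G).

Lemma steps_fingen Z Z' : steps Z Z' -> fingen Z -> fingen Z'.
Proof.
elim=> // Z1 D Z2 _ _ IH [G E]; apply: IH; exists (G ++ D); rewrite E.
apply/predeqP => x; split; move: x.
  apply: ext_min; first exact: clos_uclosed.
    apply: clos_min => [|x xG]; first exact: clos_uclosed.
    by apply: sub_clos; rewrite mem_cat xG.
  by move=> x xD; apply: sub_clos; rewrite mem_cat xD orbT.
apply: clos_min => [|x]; first exact: ext_closed.
by rewrite mem_cat => /orP [xG|/ext_r //]; apply/ext_l/sub_clos.
Qed.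

(** A generating set of a later stage [Z'] is enlarged to a strong hull and cut back to [Z']. The
    intersection is strong because good sets are, and it still generates [Z']. *)
Lemma good_reach_strong Z B : good Z -> fingen Z -> exists C, [/\ strong C,
  {subset B <= C}, good (clos u (fun x => x \in C)) & steps Z (clos u (fun x => x \in C))].
Proof.
move=> gZ fZ; have [Z' [s gZ' BZ']] := good_reach B gZ.
have [G E] := steps_fingen s fZ.
have [C' sC' BC'] := strong_hull HM (B ++ G).
have cZ' := gZ'.1.
have CZ' : clos u (fun x => x \in cap C' Z') = Z'.
  apply/predeqP => x; split; move: x.
    by apply: clos_min => // x /capP [].
  move=> x; rewrite {1}E; move: x; apply: clos_min; first exact: clos_uclosed.
  move=> x xG; apply: sub_clos; apply/capP; split; first by rewrite E; apply: sub_clos.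
  by apply: BC'; rewrite mem_cat xG orbT.
exists (cap C' Z'); rewrite CZ'; split=> //; first by apply: strong_cap => //; apply: good_Str.
by move=> x xB; apply/capP; split; [apply: BZ'|apply: BC'; rewrite mem_cat xB].
Qed.

End GoodSets.

(** * Uniqueness of rich free extensions *)

Lemma dependent_choice_nat (S : Type) (P : nat -> S -> Prop) (R : nat -> S -> S -> Prop) s0 :
  P 0 s0 -> (forall k s, P k s -> exists s', P k.+1 s' /\ R k s s') ->
  exists f : nat -> S, [/\ f 0 = s0, forall k, P k (f k) & forall k, R k (f k) (f k.+1)].
Proof.
move=> P0 PR.
have [F FP] : {F : nat * S -> S & forall p, P p.1 p.2 ->
    P p.1.+1 (F p) /\ R p.1 p.2 (F p)}.
  apply: (choice (P := fun p s => P p.1 p.2 -> P p.1.+1 s /\ R p.1 p.2 s)) => -[k s].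
  by case: (pselect (P k s)) => [/PR [s' ?]|nP]; [exists s'|exists s].
pose f := fix f k := if k is k'.+1 then F (k', f k') else s0.
have Pf k : P k (f k) by elim: k => //= k /(FP (k, f k)) [].
by exists f; split=> // k; have [] := FP (k, f k) (Pf k).
Qed.

(** The 2-adic valuation of [k.+1] serves as a schedule: it takes every value infinitely often and
    never exceeds [k]. *)
Definition target (k : nat) : nat := logn 2 k.+1.

Lemma target_le k : target k <= k.
Proof. by rewrite -ltnS; apply: ltn_logl. Qed.

Lemma target_infinite i k : exists2 j, k <= j & target j = i.
Proof.
(* The odd factor leaves the valuation equal to [i] and makes the witness at least [k]. *)
exists (2 ^ i * k.*2.+1).-1.
  rewrite -ltnS prednK ?muln_gt0 ?expn_gt0 //.
  apply: leq_trans (leq_pmull _ _); last by rewrite expn_gt0.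
  by rewrite ltnS -addnn leq_addr.
rewrite /target prednK ?muln_gt0 ?expn_gt0 // lognM ?expn_gt0 // pfactorK //.
by rewrite lognE dvdn2 /= odd_double addn0.
Qed.

Section Enumeration.
Variable V : countType.

Definition first_points (k : nat) : seq V := pmap unpickle (iota 0 k).

Lemma mem_first_points (x : V) k : pickle x < k -> x \in first_points k.
Proof.
move=> lt; rewrite mem_pmap; apply/mapP; exists (pickle x); last by rewrite pickleK.
by rewrite mem_iota.
Qed.

End Enumeration.

Section Uniqueness.
Variables (m : nat) (V : countType) (e : rel V).
Hypothesis HM : is_generic m e.
Local Notation strong := (strong e m).
Local Notation Str := (Str e m).
Local Notation aut := (aut e).
Local Notation delta2 := (delta2 e m).
Implicit Types (Z S : V -> Prop) (D A B T G : seq V) (f g : V -> V).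

Section PartialIsomorphisms.
Variable I : Type.
Implicit Types u : I -> aut.

Definition piso u u' Z Z' f g :=
  [/\ forall x, Z x -> Z' (f x) /\ g (f x) = x,
      forall y, Z' y -> Z (g y) /\ f (g y) = y,
      forall i x, Z x -> f (u i x) = u' i (f x) &
      forall x y, Z x -> Z y -> e (f x) (f y) = e x y].

Lemma piso_sym u u' Z Z' f g : uclosed u Z -> piso u u' Z Z' f g -> piso u' u Z' Z g f.
Proof.
move=> cZ [fZ gZ fu fe]; split=> // [i y Z'y|x y Z'x Z'y].
  have [Zg fg] := gZ y Z'y; rewrite -{1}fg -fu //.
  by have [] := fZ (u i (g y)) _; first exact/cZ.
have [[Zx fx] [Zy fy]] := (gZ x Z'x, gZ y Z'y).
by rewrite -{2}fx -{2}fy fe.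
Qed.

Lemma piso_strong u u' Z Z' f g A : Str Z' -> piso u u' Z Z' f g ->
  (forall x, x \in A -> Z x) -> strong A -> strong (map f A).
Proof.
move=> sZ' [fZ gZ _ fe] AZ sA T; apply: le_trans (sZ' T).
set T2 := cap T Z'; have T2Z y : y \in T2 -> Z' y by move=> /capP [].
have gmap (S : seq V) : {subset S <= T2} -> delta2 (map g S) = delta2 S.
  move=> ST; apply: delta2_map => x y /ST /T2Z /gZ [Zx fx] /ST /T2Z /gZ [Zy fy].
    by move=> E; rewrite -fx E.
  by rewrite -{2}fx -{2}fy fe.
have := sA (map g T2); rewrite gmap // => H.
have capT2 : {subset cap T (fun x => x \in map f A) <= T2}.
  move=> y /capP [/mapP [x xA ->] xT]; apply/capP; split=> //.
  by have [] := fZ x (AZ x xA).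
rewrite -(gmap _ capT2); apply: le_trans H.
rewrite (delta2_eqi e m (B := cap (map g T2) (fun x => x \in A))) // => x.
apply/mapP/capP.
  move=> [y yc ->]; split; last by apply/map_f/capT2.
  by move: yc => /capP [/mapP [z zA ->] _]; have [_ ->] := fZ z (AZ z zA).
move=> [xA /mapP [y yT2 xE]]; exists y => //; apply/capP.
have [_ fy] := gZ y (T2Z y yT2); split; last by move: yT2 => /capP [].
by rewrite -fy -xE; apply: map_f.
Qed.

(** Homogeneity extends [f] from the strong set [cap D Z] to an automorphism, and [good_ext] moves
    the image of [D] to a copy free over [Z']. The universal properties of both sides extend [f] and
    [g] to equivariant homomorphisms, which are inverse on generators and hence everywhere. *)
Lemma piso_forth_one u u' Z Z' f g D :
  free_step m u Z D -> good m u' Z' -> piso u u' Z Z' f g ->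
  exists Z1' f' g', [/\ good m u' Z1', piso u u' (ext u Z D) Z1' f' g',
    forall x, Z x -> f' x = f x & forall y, Z' y -> Z1' y].
Proof.
move=> fs gZ' pi; have [cZ sD sA free] := fs.
have [fZ gZ fu fe] := pi.
pose A := cap D Z; have AZ x : x \in A -> Z x by move=> /capP [].
have AD : {subset A <= D} by move=> x /capP [].
have sfA : strong (map f A) by apply: piso_strong pi AZ sA; apply: good_Str gZ'.
have [||h hE] := homogeneity HM sA sfA.
- move=> x y /AZ /fZ [_ fx] /AZ /fZ [_ fy] E.
  by rewrite -fx E.
- by move=> x y /AZ Zx /AZ Zy; apply: fe.
have [||k [kA fs' kD good']] := good_ext gZ' sfA (strong_map h sD).
- by move=> _ /mapP [x xA ->]; rewrite -hE //; apply/map_f/AD.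
- by move=> _ /mapP [y /AZ /fZ [Zy _] ->].
have [cZ' sD' sA' free'] := fs'.
pose p : aut := acomp k h.
have pA x : x \in A -> p x = f x by move=> xA; rewrite /= hE // kA //; apply: map_f.
have pD x : x \in D -> Z' (p x) -> x \in A.
  move=> xD /= /(kD (h x) (map_f _ xD)) /mapP [y yA E].
  by have := hE y yA; rewrite -E => /af_inj <-.
set D' := map k (map h D) in fs' sD' sA' free' good'.
have D'E y : (y \in D') = (ab p y \in D) by rewrite /D' !mem_map_autV.
have pD' x : x \in D -> p x \in D' by move=> xD; rewrite D'E afK.
pose f0 x := if `[< Z x >] then f x else p x.
have f0Z x : Z x -> f0 x = f x by move=> Zx; rewrite /f0 asboolT.
have f0D x : x \in D -> f0 x = p x.
  by move=> xD; rewrite /f0; case: asboolP => // Zx; rewrite pA //; apply/capP.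
pose g0 y := if `[< Z' y >] then g y else ab p y.
have g0Z y : Z' y -> g0 y = g y by move=> Zy; rewrite /g0 asboolT.
have g0D y : y \in D' -> g0 y = ab p y.
  rewrite D'E => yD; rewrite /g0; case: asboolP => // Zy.
  have yA : ab p y \in A by apply: pD => //; rewrite abK.
  have E : y = f (ab p y) by rewrite -pA // abK.
  by rewrite {1}E; have [_ ->] := fZ _ (AZ _ yA).
have [|||f1 [f1E ef1 hf1]] := free (fgraphV u') f0.
- by move=> i x Zx; rewrite !f0Z ?fu //; apply/cZ.
- by move=> x y Zx Zy exy; rewrite !f0Z //= fe.
- by move=> x y xD yD exy; rewrite !f0D //= !af_edge.
have [_ _ gu ge] := piso_sym cZ pi.
have [|||g1 [g1E eg1 hg1]] := free' (fgraphV u) g0.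
- by move=> i x Zx; rewrite !g0Z ?gu //; apply/cZ'.
- by move=> x y Zx Zy exy; rewrite !g0Z //= ge.
- by move=> x y xD yD exy; rewrite !g0D //= ab_edge ab_edge.
rewrite -/(ext u Z D) in ef1 hf1; rewrite -/(ext u' Z' D') in eg1 hg1.
have f1_ext x : ext u Z D x -> ext u' Z' D' (f1 x).
  case=> w [q [Zq ->]]; rewrite (eqvar_act w (@ext_closed _ _ _ _ _ _) ef1); last exact: sub_clos.
  apply/(closed_act w _ (@ext_closed _ _ _ _ _ _)); rewrite f1E //.
  by case: Zq => [Zq|qD]; [rewrite f0Z //; apply/ext_l/(fZ q Zq).1|rewrite f0D //; apply/ext_r/pD'].
have g1_ext y : ext u' Z' D' y -> ext u Z D (g1 y).
  case=> w [q [Zq ->]]; rewrite (eqvar_act w (@ext_closed _ _ _ _ _ _) eg1); last exact: sub_clos.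
  apply/(closed_act w _ (@ext_closed _ _ _ _ _ _)); rewrite g1E //.
  case: Zq => [Zq|qD]; [rewrite g0Z //; apply/ext_l/(gZ q Zq).1|rewrite g0D //; apply/ext_r].
  by rewrite -D'E.
have gf1 x : ext u Z D x -> g1 (f1 x) = x.
  case=> w [q [Zq ->]]; have Eq : ext u Z D q by apply: sub_clos.
  rewrite (eqvar_act w (@ext_closed _ _ _ _ _ _) ef1) //.
  rewrite (eqvar_act w (@ext_closed _ _ _ _ _ _) eg1); last exact: f1_ext.
  congr act; rewrite f1E // g1E; case: Zq => [Zq|qD].
  - by rewrite f0Z // g0Z; have [] := fZ q Zq.
  - by rewrite f0D // g0D ?afK //; apply: pD'.
  - by rewrite f0Z //; left; have [] := fZ q Zq.
  - by rewrite f0D //; right; apply: pD'.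
have fg1 y : ext u' Z' D' y -> f1 (g1 y) = y.
  case=> w [q [Zq ->]]; have Eq : ext u' Z' D' q by apply: sub_clos.
  rewrite (eqvar_act w (@ext_closed _ _ _ _ _ _) eg1) //.
  rewrite (eqvar_act w (@ext_closed _ _ _ _ _ _) ef1); last exact: g1_ext.
  congr act; rewrite g1E // f1E; case: Zq => [Zq|qD].
  - by rewrite g0Z // f0Z; have [] := gZ q Zq.
  - by rewrite g0D // f0D ?abK // -D'E.
  - by rewrite g0Z //; left; have [] := gZ q Zq.
  - by rewrite g0D //; right; rewrite -D'E.
exists (ext u' Z' D'), f1, g1; split=> //.
- split=> // [x Zx|y Zy|x y Zx Zy].
  + by split; [apply: f1_ext|apply: gf1].
  + by split; [apply: g1_ext|apply: fg1].
  + apply/idP/idP => [exy|]; last exact: hf1.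
    by rewrite -(gf1 x Zx) -(gf1 y Zy); apply: hg1 => //; apply: f1_ext.
- by move=> x Zx; rewrite f1E ?f0Z //; left.
- by move=> y Zy; apply: ext_l.
Qed.

Lemma piso_forth u u' Z W Z' f g :
  steps m u Z W -> good m u' Z' -> piso u u' Z Z' f g ->
  exists Z1' f' g', [/\ good m u' Z1', piso u u' W Z1' f' g',
    forall x, Z x -> f' x = f x & forall y, Z' y -> Z1' y].
Proof.
move=> s; elim: s Z' f g => {Z W} [Z|Z D W fs _ IH] Z' f g gZ' pi.
  by exists Z', f, g.
have [Z1' [f1 [g1 [good1 pi1 f1E sub1]]]] := piso_forth_one fs gZ' pi.
have [Z2' [f2 [g2 [good2 pi2 f2E sub2]]]] := IH _ _ _ good1 pi1.
exists Z2', f2, g2; split=> // [x Zx|y /sub1 /sub2 //].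
by rewrite f2E ?f1E //; apply: ext_l.
Qed.

(** Back and forth: each round enlarges both sides by [piso_forth], the second time with the sides
    exchanged by [piso_sym]. The union of the coherent partial isomorphisms is total. *)
Theorem good_unique u u' Z Z' f g :
  good m u Z -> good m u' Z' -> piso u u' Z Z' f g ->
  exists h : aut, (forall x, Z x -> h x = f x) /\ forall i x, h (u i x) = u' i (h x).
Proof.
move=> gZ gZ' pi.
pose St : Type := ((V -> Prop) * (V -> Prop) * (V -> V) * (V -> V))%type.
pose P (k : nat) (s : St) := let: (Z, Z', f, g) := s in
  [/\ good m u Z, good m u' Z', piso u u' Z Z' f g &
    {in first_points V k, forall x, Z x /\ Z' x}].
pose R (k : nat) (s t : St) := let: (Z, Z', f, g) := s in let: (Z1, Z1', f1, g1) := t in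
  [/\ forall x, Z x -> Z1 x, forall x, Z' x -> Z1' x & forall x, Z x -> f1 x = f x].
have [||s [s0 sP sR]] := @dependent_choice_nat St P R (Z, Z', f, g).
- by split.
- move=> k [[[{gZ gZ' pi}Z {}Z'] {}f] {}g] [gZ gZ' pi _].
  have [Z1 [st gZ1 xZ1]] := good_reach (first_points V k.+1) gZ.
  have [Z1' [f1 [g1 [gZ1' pi1 f1E Z'Z1']]]] := piso_forth st gZ' pi.
  have [Z2' [st' gZ2' xZ2']] := good_reach (first_points V k.+1) gZ1'.
  have [Z2 [g2 [f2 [gZ2 pi2 g2E Z1Z2]]]] := piso_forth st' gZ1 (piso_sym gZ1.1 pi1).
  exists (Z2, Z2', f2, g2); split; split=> //.
  + by apply: piso_sym pi2; case: gZ2'.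
  + by move=> x xk; split; [apply/Z1Z2/xZ1|apply: xZ2'].
  + by move=> x /(steps_sub st) /Z1Z2.
  + by move=> x /Z'Z1' /(steps_sub st').
  (* The backward half extends the inverse, [g2] over [g1]; hence [f2] extends [f1]. *)
  + move=> x Zx; rewrite -f1E //.
    have Z1x : Z1 x by apply: steps_sub st Zx.
    have [f1Z1 g1f1] : Z1' (f1 x) /\ g1 (f1 x) = x by case: pi1 => H _ _ _; apply: H.
    have [E1 E2] : Z2 (g2 (f1 x)) /\ f2 (g2 (f1 x)) = f1 x.
      by case: pi2 => H _ _ _; apply: H; apply: steps_sub st' f1Z1.
    by rewrite -E2 g2E // g1f1.
pose Zk k := (s k).1.1.1; pose Zk' k := (s k).1.1.2.
pose fk k := (s k).1.2; pose gk k := (s k).2.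
have pik k : piso u u' (Zk k) (Zk' k) (fk k) (gk k).
  by move: (sP k); rewrite /P /Zk /Zk' /fk /gk; case: (s k) => [[[? ?] ?] ?] [].
have in_k k x : pickle x < k -> Zk k x /\ Zk' k x.
  move=> lt; move: (sP k); rewrite /P /Zk /Zk'; case: (s k) => [[[? ?] ?] ?] [_ _ _].
  by apply; apply: mem_first_points.
have stepk k : (forall x, Zk k x -> Zk k.+1 x) /\ forall x, Zk k x -> fk k.+1 x = fk k x.
  move: (sR k); rewrite /R /Zk /fk; case: (s k) => [[[? ?] ?] ?].
  by case: (s k.+1) => [[[? ?] ?] ?] [].
have mono i j : i <= j -> (forall x, Zk i x -> Zk j x) /\ forall x, Zk i x -> fk j x = fk i x.
  elim: j => [|j IH]; first by rewrite leqn0 => /eqP ->.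
  rewrite leq_eqVlt => /orP [/eqP -> //|/IH [IH1 IH2]]; have [S1 S2] := stepk j.
  by split=> x Zx; [apply/S1/IH1|rewrite S2 ?IH2 //; apply: IH1].
(* At stage [n x] the point [x] lies on both sides, by the condition on [first_points]; any other
   stage containing [x] gives the same value. *)
pose n x := (pickle (x : V)).+1.
pose h x := fk (n x) x; pose h' y := gk (n y) y.
have hE k x : Zk k x -> h x = fk k x.
  move=> Zx; have [Zn _] := in_k (n x) x (leqnn _).
  case: (leqP k (n x)) => [le|/ltnW le]; first by rewrite /h (mono _ _ le).2.
  by rewrite /h (mono _ _ le).2.
have hK : cancel h h'.
  move=> x; pose k := maxn (n x) (n (h x)).
  have Zx : Zk k x by apply: (in_k k x _).1; rewrite /k leq_max leqnn.
  have [_ Z'y] := in_k (n (h x)) (h x) (leqnn _).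
  have [H1 H2 _ _] := pik (n (h x)); have [Zg fg] := H2 _ Z'y.
  have Zgk : Zk k (h' (h x)) by apply: (mono _ _ (leq_maxr _ _)).1 Zg.
  have [K1 _ _ _] := pik k.
  have E : fk k (h' (h x)) = fk k x.
    by rewrite -(hE k _ Zgk) -(hE k _ Zx) (hE _ _ Zg); apply: fg.
  by rewrite -(K1 _ Zgk).2 E (K1 _ Zx).2.
have Kh : cancel h' h.
  move=> y; have [_ Z'y] := in_k (n y) y (leqnn _).
  have [_ H2 _ _] := pik (n y); have [Zg fg] := H2 _ Z'y.
  by rewrite (hE (n y)).
have he x y : e (h x) (h y) = e x y.
  pose k := maxn (n x) (n y).
  have Zx : Zk k x by apply: (in_k k x _).1; rewrite /k leq_max leqnn.
  have Zy : Zk k y by apply: (in_k k y _).1; rewrite /k leq_max leqnn orbT.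
  by rewrite !(hE k) //; case: (pik k) => _ _ _; apply.
exists (Aut hK Kh he); split=> /= [x Zx|i x].
  by rewrite (hE 0) /Zk /fk s0.
have [Zx _] := in_k (n x) x (leqnn _).
have Zux : Zk (n x) (u i x).
  have : uclosed u (Zk (n x)).
    by move: (sP (n x)); rewrite /P /Zk; case: (s (n x)) => [[[? ?] ?] ?] [[]].
  by move=> c; apply/c.
by rewrite (hE (n x)) // (hE (n x) x) //; case: (pik (n x)) => _ _ H _; apply: H.
Qed.

End PartialIsomorphisms.
End Uniqueness.

(** * Generic automorphisms over an action *)

Definition fgraph_restrict (I : Type) (N : fgraph (option I)) : fgraph I :=
  @FGraph I N (@fedge _ N) (fun i => fmap (f := N) (Some i)) (fun i => fmapV (f := N) (Some i))
    (fun i => fmapK (f := N) (Some i)) (fun i => fmapVK (f := N) (Some i))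
    (fun i => @fmap_edge _ N (Some i)) (fun i => @fmapV_edge _ N (Some i)).

Section GenericOver.
Variables (m : nat) (V : countType) (e : rel V).
Hypothesis HM : is_generic m e.
Local Notation strong := (strong e m).
Local Notation aut := (aut e).
Implicit Types (Z S : V -> Prop) (D A B C T Y : seq V).

(** The [a k] are total, but only their values on [Y k] are final. Exhausting the ranges as well as
    the domains makes the limit surjective. *)
Lemma aut_limit (a : nat -> aut) (Y : nat -> seq V) :
  (forall k, {subset Y k <= Y k.+1}) -> (forall k, {in Y k, a k.+1 =1 a k}) ->
  (forall x, exists k, x \in Y k) -> (forall x, exists k, x \in map (a k) (Y k)) ->
  exists b : aut, forall k, {in Y k, b =1 a k}.
Proof.
move=> Ysub aE YV aV.
have mono i j : i <= j -> {subset Y i <= Y j} /\ {in Y i, a j =1 a i}.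
  elim: j => [|j IH]; first by rewrite leqn0 => /eqP ->; split.
  rewrite leq_eqVlt => /orP [/eqP ->|/IH [s1 s2]]; first by split.
  by split=> x xY; [apply/Ysub/s1|rewrite aE ?s2 //; apply: s1].
have [n nE] := choice YV; have [n' n'E] := choice aV.
pose b x := a (n x) x; pose b' y := ab (a (n' y)) y.
have bE k : {in Y k, b =1 a k}.
  move=> x xY; case: (leqP k (n x)) => [le|/ltnW le]; first exact: (mono _ _ le).2.
  by rewrite (mono _ _ le).2.
have b'Y y : b' y \in Y (n' y) by rewrite /b' -mem_map_autV.
have bK : cancel b' b by move=> y; rewrite (bE _ _ (b'Y y)) abK.
have common x y : exists k, x \in Y k /\ y \in Y k.
  exists (maxn (n x) (n y)); split.
    exact: (mono _ _ (leq_maxl _ _)).1 _ (nE x).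
  exact: (mono _ _ (leq_maxr _ _)).1 _ (nE y).
have inj : injective b.
  by move=> x y; have [k [xk yk]] := common x y; rewrite !(bE k) //; apply: af_inj.
have Kb : cancel b b' by move=> x; apply: inj; rewrite bK.
have be x y : e (b x) (b y) = e x y.
  by have [k [xk yk]] := common x y; rewrite !(bE k) // af_edge.
by exists (Aut Kb bK be).
Qed.

Section OneMore.
Variables (I : Type) (u : I -> aut).
Local Notation mset C := (fun x => x \in (C : seq V)).

Definition ocons (w : aut) (j : option I) : aut := if j is Some i then u i else w.

(* [go_free] and [go_good] say that, apart from fixing [C], [w] is as free as possible over
   the action of [u]. *)
Record generic_over C (w : aut) : Prop := GenericOver {
  go_strong : strong C;
  go_fix : {in C, w =1 id};
  go_free : forall (N : fgraph (option I)) (f : V -> N),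
    eqvar (N := fgraph_restrict N) u (clos u (mset C)) f ->
    homo e (N := N) (clos u (mset C)) f ->
    (forall c, c \in C -> fmap None (f c) = f c) ->
    exists g : V -> N, [/\ forall x, clos u (mset C) x -> g x = f x,
      eqvar (ocons w) (clos (ocons w) (mset C)) g &
      homo e (N := N) (clos (ocons w) (mset C)) g];
  go_good : good m (ocons w) (clos (ocons w) (mset C)) }.

(** Freeness of [w] is applied with target [V] under the action in which [w'] replaces [w], and
    conversely. The two maps fix [C] and are equivariant, hence mutually inverse on the closures of
    [C]; [good_unique] extends them to [V]. *)
Lemma generic_over_conj C w w' : generic_over C w -> generic_over C w' ->
  exists a : aut, [/\ {in C, a =1 id}, forall i x, a (u i x) = u i (a x) &
    forall x, a (w x) = w' (a x)].
Proof.
move=> gw gw'.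
have half v v' : generic_over C v -> generic_over C v' -> exists g : V -> V,
    [/\ {in C, g =1 id}, eqvar (N := fgraphV (ocons v')) (ocons v) (clos (ocons v) (mset C)) g &
    homo e (N := fgraphV (ocons v')) (clos (ocons v) (mset C)) g].
  move=> [_ _ free _] [_ fix' _ _].
  have [|||g [gE eg hg]] := free (fgraphV (ocons v')) id.
  - by [].
  - by move=> x y _ _.
  - by move=> c cC /=; rewrite fix'.
  by exists g; split=> // x xC; rewrite gE //; apply: sub_clos.
have [g [gC eg hg]] := half _ _ gw gw'; have [g' [g'C eg' hg']] := half _ _ gw' gw.
have gact v v' h wd c : {in C, h =1 id} ->
    eqvar (N := fgraphV (ocons v')) (ocons v) (clos (ocons v) (mset C)) h -> c \in C ->
    h (act (N := fgraphV (ocons v)) wd c) = act (N := fgraphV (ocons v')) wd c.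
  move=> hC eh cC; rewrite (eqvar_act wd (@clos_uclosed _ _ _ _ _) eh) ?hC //.
  exact: sub_clos.
have pi : piso (ocons w) (ocons w') (clos (ocons w) (mset C)) (clos (ocons w') (mset C)) g g'.
  split=> //.
  - move=> _ [wd [c [cC ->]]]; rewrite !(gact w w') // !(gact w' w) //.
    by split=> //; exists wd, c.
  - move=> _ [wd [c [cC ->]]]; rewrite !(gact w' w) // !(gact w w') //.
    by split=> //; exists wd, c.
  - move=> x y Sx Sy; apply/idP/idP => [exy|]; last exact: hg.
    have gS z : clos (ocons w) (mset C) z ->
        clos (ocons w') (mset C) (g z) /\ g' (g z) = z.
      move=> [wd [c [cC ->]]]; rewrite !(gact w w') // !(gact w' w) //.
      by split=> //; exists wd, c.
    have [[S'x gx] [S'y gy]] := (gS x Sx, gS y Sy).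
    by rewrite -gx -gy; apply: hg'.
have [a [aE au]] := good_unique HM (go_good gw) (go_good gw') pi.
exists a; split=> [c cC|i x|x]; last exact: (au None x).
  by rewrite aE ?gC //; apply: sub_clos.
exact: (au (Some i) x).
Qed.

Lemma free_step_extend (N : fgraph I) Z D (f p : V -> N) : free_step m u Z D ->
  eqvar u Z f -> homo e Z f -> homo e (mset D) p ->
  (forall x, x \in D -> Z x -> p x = f x) ->
  exists g : V -> N, [/\ forall x, Z x -> g x = f x, forall x, x \in D -> g x = p x,
    eqvar u (ext u Z D) g & homo e (ext u Z D) g].
Proof.
move=> [cZ _ _ free] ef hf hp pf.
pose f' x := if `[< Z x >] then f x else p x.
have f'Z x : Z x -> f' x = f x by move=> Zx; rewrite /f' asboolT.
have f'D x : x \in D -> f' x = p x.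
  by move=> xD; rewrite /f'; case: asboolP => // Zx; rewrite pf.
have [|||g [gE eg hg]] := free N f'.
- by move=> i x Zx; rewrite !f'Z ?ef //; apply/cZ.
- by move=> x y Zx Zy exy; rewrite !f'Z //; apply: hf.
- by move=> x y xD yD exy; rewrite !f'D //; apply: hp.
exists g; split=> // x hx; first by rewrite gE ?f'Z //; left.
by rewrite gE ?f'D //; right.
Qed.

(** * Automorphisms built by free choices of images and preimages *)

Section Pairs.
Variables (a b : aut).

(* The automorphism under construction maps [a y] to [b y]; it is decided at the points of
   [map a Y], and every newly decided value or preimage is chosen freely over the part [Z]
   built so far. *)
Inductive psteps : (V -> Prop) -> seq V -> (V -> Prop) -> seq V -> Prop :=
| ps_refl Z Y : psteps Z Y Z Y
| ps_new Z Y D Z' Y' : free_step m u Z D -> psteps (ext u Z D) Y Z' Y' -> psteps Z Y Z' Y'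
| ps_image Z Y Y1 Z' Y' : {subset Y <= Y1} -> (forall y, y \in Y1 -> Z (a y)) ->
    free_step m u Z (map b Y1) -> (forall y, y \in Y1 -> Z (b y) -> y \in Y) ->
    psteps (ext u Z (map b Y1)) Y1 Z' Y' -> psteps Z Y Z' Y'
| ps_preimage Z Y Y1 Z' Y' : {subset Y <= Y1} -> (forall y, y \in Y1 -> Z (b y)) ->
    free_step m u Z (map a Y1) -> (forall y, y \in Y1 -> Z (a y) -> y \in Y) ->
    psteps (ext u Z (map a Y1)) Y1 Z' Y' -> psteps Z Y Z' Y'.

Definition placed Z Y := forall y, y \in Y -> Z (a y) /\ Z (b y).

Lemma psteps_trans Z Y Z1 Y1 Z2 Y2 :
  psteps Z Y Z1 Y1 -> psteps Z1 Y1 Z2 Y2 -> psteps Z Y Z2 Y2.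
Proof.
elim=> // {Z Y Z1 Y1} [Z Y D Z1 Y1 fs _ IH /IH|Z Y Y0 Z1 Y1 s p fs d _ IH /IH|
  Z Y Y0 Z1 Y1 s p fs d _ IH /IH]; first exact: ps_new fs.
  exact: ps_image fs d.
exact: ps_preimage fs d.
Qed.

Lemma steps_psteps Z Z' Y : steps m u Z Z' -> psteps Z Y Z' Y.
Proof. by elim=> {Z Z'} [Z|Z D Z' fs _ IH]; [exact: ps_refl|exact: ps_new fs IH]. Qed.

Lemma psteps_subset Z Y Z' Y' : psteps Z Y Z' Y' -> {subset Y <= Y'}.
Proof.
by elim=> {Z Y Z' Y'} [Z Y|Z Y D Z' Y' _ _|Z Y Y1 Z' Y' s _ _ _ _ IH x /s /IH|
  Z Y Y1 Z' Y' s _ _ _ _ IH x /s /IH].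
Qed.

Lemma psteps_placed Z Y Z' Y' : psteps Z Y Z' Y' -> placed Z Y -> placed Z' Y'.
Proof.
elim=> // {Z Y Z' Y'} [Z Y D Z' Y' fs _ IH pl|Z Y Y1 Z' Y' s p fs d _ IH pl|
  Z Y Y1 Z' Y' s p fs d _ IH pl]; apply: IH => y yY.
    by have [] := pl y yY; split; apply: ext_l.
  by split; [apply/ext_l/p|apply/ext_r/map_f].
by split; [apply/ext_r/map_f|apply/ext_l/p].
Qed.

Lemma psteps_steps Z Y Z' Y' : psteps Z Y Z' Y' -> steps m u Z Z'.
Proof.
by elim=> {Z Y Z' Y'} [*|Z Y D Z' Y' fs _ s|Z Y Y1 Z' Y' _ _ fs _ _ s|Z Y Y1 Z' Y' _ _ fs _ _ s];
  [exact: steps_refl|exact: steps_cons fs s|exact: steps_cons fs s|exact: steps_cons fs s].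
Qed.

Let w : aut := acomp b (ainv a).
Local Notation up Z := (clos (ocons w) Z).

Section Target.
Variable N0 : fgraph (option I).
Let N := fgraph_option N0.

Definition compatible Z Y (f : V -> N) :=
  [/\ eqvar (N := fgraph_restrict N) u Z f, homo e (N := N) Z f &
    forall y, y \in Y -> f (b y) = fmap None (f (a y))].

(** At a new step the points of [D] outside [Z] go to [None], which is why the target has such a
    point. At an image step the value at [b y] is forced by that at [a y], consistently since only
    points of [Y] were decided before; preimage steps are the mirror case. *)
Lemma psteps_extend Z Y Z' Y' f : psteps Z Y Z' Y' -> placed Z Y -> compatible Z Y f ->
  exists2 g, compatible Z' Y' g & forall x, Z x -> g x = f x.
Proof.
move=> s; elim: s f => {Z Y Z' Y'} [Z Y f _|Z Y D Z' Y' fs _ IH f pl [ef hf fY]|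
  Z Y Y1 Z' Y' s p fs d _ IH f pl [ef hf fY]|Z Y Y1 Z' Y' s p fs d _ IH f pl [ef hf fY]].
- by exists f.
- pose q x : N := if `[< Z x >] then f x else None.
  have [||g [gZ _ eg hg]] := free_step_extend (N := fgraph_restrict N) (p := q) fs ef hf.
  + move=> x y _ _ exy; rewrite /q; case: asboolP => // Zx; case: asboolP => [Zy|_].
      exact: hf.
    by case: (f x).
  + by move=> x _ Zx; rewrite /q asboolT.
  have [||h ch hg'] := IH g.
  + by move=> y yY; have [] := pl y yY; split; apply: ext_l.
  + by split=> // y yY; have [] := pl y yY => *; rewrite !gZ ?fY.
  by exists h => // x Zx; rewrite hg' ?gZ //; apply: ext_l.
- pose q x : N := fmap None (f (a (ab b x))).
  have qE y : q (b y) = fmap None (f (a y)) by rewrite /q afK.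
  have [||g [gZ gD eg hg]] := free_step_extend (N := fgraph_restrict N) (p := q) fs ef hf.
  + move=> _ _ /mapP [x xY ->] /mapP [y yY ->]; rewrite af_edge => exy.
    by rewrite !qE; apply: (@fmap_edge _ N); apply: hf; rewrite ?af_edge //; apply: p.
  + by move=> _ /mapP [y yY ->] /(d y yY) /fY ->; rewrite qE.
  have [||h ch hg'] := IH g.
  + by move=> y yY; split; [apply/ext_l/p|apply/ext_r/map_f].
  + split=> // y yY; rewrite gD ?qE; last exact: map_f.
    by rewrite gZ //; apply: p.
  by exists h => // x Zx; rewrite hg' ?gZ //; apply: ext_l.
- pose q x : N := fmapV None (f (b (ab a x))).
  have qE y : q (a y) = fmapV None (f (b y)) by rewrite /q afK.
  have [||g [gZ gD eg hg]] := free_step_extend (N := fgraph_restrict N) (p := q) fs ef hf.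
  + move=> _ _ /mapP [x xY ->] /mapP [y yY ->]; rewrite af_edge => exy.
    by rewrite !qE; apply: (@fmapV_edge _ N); apply: hf; rewrite ?af_edge //; apply: p.
  + by move=> _ /mapP [y yY ->] /(d y yY) /fY E; rewrite qE E fmapK.
  have [||h ch hg'] := IH g.
  + by move=> y yY; split; [apply/ext_r/map_f|apply/ext_l/p].
  + split=> // y yY; rewrite (gD (a y)) ?qE ?fmapVK; last exact: map_f.
    by rewrite gZ //; apply: p.
  by exists h => // x Zx; rewrite hg' ?gZ //; apply: ext_l.
Qed.

End Target.

(** No choice made after [Z] and [Y] obstructs a map compatible so far, even for the action enlarged
    by [w]. This is the form in which freeness is carried backwards along [psteps]. *)
Definition live Z Y := forall (N0 : fgraph (option I)) (f : V -> fgraph_option N0),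
  compatible Z Y f -> exists g : V -> fgraph_option N0,
    [/\ forall x, Z x -> g x = f x, eqvar (ocons w) (fun=> True) g &
        homo e (N := fgraph_option N0) (fun=> True) g].

Lemma live_psteps Z Y Z' Y' : psteps Z Y Z' Y' -> placed Z Y -> live Z' Y' -> live Z Y.
Proof.
move=> s pl lv N0 f cf; have [g cg gf] := psteps_extend s pl cf.
have [h [hE eh hh]] := lv _ _ cg; exists h; split=> // x Zx.
by rewrite hE ?gf //; apply: steps_sub (psteps_steps s) Zx.
Qed.

Lemma mem_up Z x : Z x -> up Z x. Proof. exact: sub_clos. Qed.

Lemma up_sub Z Z' : (forall x, Z x -> up Z' x) -> forall x, up Z x -> up Z' x.
Proof. by move=> ZZ'; apply: clos_min => //; apply: clos_uclosed. Qed.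

Lemma up_uclosed Z : uclosed u (up Z).
Proof. by move=> i x; apply: (@clos_uclosed _ _ _ (ocons w) Z (Some i)). Qed.

Lemma up_pair Z y : up Z (b y) <-> up Z (a y).
Proof.
have := @clos_uclosed _ _ _ (ocons w) Z None (a y).
by rewrite /= afK.
Qed.

Lemma up_ext Z D : ext (ocons w) (up Z) D = up (ext u Z D).
Proof.
apply/predeqP => x; split; move: x.
  apply: ext_min; first exact: clos_uclosed.
    by apply: up_sub => x Zx; apply/mem_up/ext_l.
  by move=> x xD; apply/mem_up/ext_r.
apply: clos_min; first exact: ext_closed.
apply: ext_min => [i x|x Zx|x]; last exact: ext_r.
  exact: (@ext_closed _ _ _ (ocons w) (up Z) D (Some i)).
by apply/ext_l/mem_up.
Qed.

(** A map for the action with [w] is restricted to [Z] and [D], extended by freeness for [u], and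
    then by liveness to all of [V]; by equivariance it agrees with the given map on [up Z]. *)
Lemma free_step_up Z Y D : free_step m u Z D -> placed Z Y -> live (ext u Z D) Y ->
  free_step m (ocons w) (up Z) D /\ forall x, x \in D -> up Z x -> Z x.
Proof.
move=> fs pl lv; have [cZ sD sA free] := fs.
have DZ x : x \in D -> up Z x -> Z x.
  move=> xD Zx; apply: contrapT => nZx.
  (* In the target with one fixed point besides [None], the set [Z] goes to that point and the rest
     of [D] to [None]. Equivariance keeps [up Z] away from [None], so [D] meets [up Z] only inside
     [Z]. *)
  pose N0 : fgraph (option I) := @FGraph (option I) unit (fun _ _ => True)
    (fun _ => id) (fun _ => id) (fun _ _ => erefl) (fun _ _ => erefl) (fun _ _ _ _ => Logic.I) (fun _ _ _ _ => Logic.I).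
  pose f (y : V) : fgraph_option N0 := if `[< Z y >] then Some tt else None.
  have fZ y : Z y -> f y = Some tt by move=> Zy; rewrite /f asboolT.
  have triv (y z : V) (g h : V -> fgraph_option N0) : fedge (g y) (h z).
    by rewrite /=; case: (g y) => //; case: (h z).
  have [||||g [gZ gD eg hg]] := @free_step_extend (fgraph_restrict (fgraph_option N0)) Z D f f fs.
  - by move=> i y Zy; rewrite !fZ //; apply/cZ.
  - by move=> *; apply: triv.
  - by move=> *; apply: triv.
  - by [].
  have [|h [hE eh _]] := lv N0 g.
    by split=> // y yY; have [] := pl y yY => *; rewrite !gZ // !fZ.
  have : h x = None by rewrite hE ?gD /f ?asboolF //; apply: ext_r.
  case: Zx => wd [z [Zz ->]].
  rewrite (eqvar_act wd _ eh) // hE ?gZ ?fZ //; first by rewrite act_option.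
  exact: ext_l.
split=> //; split=> //; first exact: clos_uclosed.
  apply: strong_eqi sA => x; apply/capP/capP => -[Zx xD]; split=> //; first exact: mem_up.
  exact: DZ.
move=> N0 f ef hf hD.
pose f' x : fgraph_option N0 := Some (f x).
have [||||g [gZ gD eg hg]] :=
    @free_step_extend (fgraph_restrict (fgraph_option N0)) Z D f' f' fs.
- by move=> i x Zx; rewrite /f' (ef (Some i)) //; apply: mem_up.
- by move=> x y Zx Zy; apply: hf; apply: mem_up.
- exact: hD.
- by [].
have [|h [hE eh hh]] := lv N0 g.
  split=> // y yY; have [Za Zb] := pl y yY; rewrite !gZ // /f'.
  by rewrite /= -(ef None) /= ?afK //; apply: mem_up.
rewrite -/(ext (ocons w) (up Z) D) up_ext.
have hS x : up (ext u Z D) x -> exists y, h x = Some y.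
  case=> wd [z [Zz ->]]; rewrite (eqvar_act wd _ eh) // hE //.
  suff [y ->] : exists y, g z = Some y by exists (act wd y); rewrite act_option.
  case: Zz => wd' [z' [Zz' ->]]; rewrite (eqvar_act wd' _ eg); last exact: sub_clos.
    exists (act (N := fgraph_restrict N0) wd' (f z')).
    have -> : g z' = Some (f z') by case: Zz' => [/gZ|/gD].
    by elim: wd' => [|[i []] wd' IH] //=; rewrite IH.
  exact: ext_closed.
have hf' x : up Z x \/ x \in D -> h x = Some (f x).
  case=> [[wd [z [Zz ->]]]|xD]; last by rewrite hE ?gD //; apply: ext_r.
  rewrite (eqvar_act wd _ eh) // hE; last exact: ext_l.
  rewrite gZ // act_option (eqvar_act wd _ ef) //; first exact: clos_uclosed.
  exact: mem_up.
exists (fun x => odflt (f x) (h x)); split=> [x Zx|j x Zx|x y Zx Zy exy].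
- by rewrite hf'.
- by have [y hx] := hS x Zx; rewrite eh // hx.
- have [[x' hx] [y' hy]] := (hS x Zx, hS y Zy).
  by have := hh x y Logic.I Logic.I exy; rewrite hx hy.
Qed.

(** Image and preimage steps only add what [u] generates from [Z] and translates of its points by
    [w] or its inverse, so [up Z] does not change. The [ps_new] steps remain, and liveness makes
    them free for the larger action. *)
Lemma psteps_up Z Y Z' Y' : psteps Z Y Z' Y' -> placed Z Y -> live Z' Y' ->
  steps m (ocons w) (up Z) (up Z').
Proof.
elim=> {Z Y Z' Y'} [Z Y|Z Y D Z' Y' fs s IH pl lv|Z Y Y1 Z' Y' sY p fs d s IH pl lv|
  Z Y Y1 Z' Y' sY p fs d s IH pl lv].
- by move=> *; apply: steps_refl.
- have pl' : placed (ext u Z D) Y by move=> y yY; have [] := pl y yY; split; apply: ext_l.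
  have [fs' _] := free_step_up fs pl (live_psteps s pl' lv).
  by apply: steps_cons fs' _; rewrite up_ext; apply: IH.
- have -> : up Z = up (ext u Z (map b Y1)).
    apply/predeqP => x; split; move: x; apply: up_sub; first by move=> x Zx; apply/mem_up/ext_l.
    apply: ext_min; [exact: up_uclosed|by move=> x; apply: mem_up|].
    by move=> _ /mapP [y yY ->]; apply/up_pair/mem_up/p.
  by apply: IH => // y yY; split; [apply/ext_l/p|apply/ext_r/map_f].
- have -> : up Z = up (ext u Z (map a Y1)).
    apply/predeqP => x; split; move: x; apply: up_sub; first by move=> x Zx; apply/mem_up/ext_l.
    apply: ext_min; [exact: up_uclosed|by move=> x; apply: mem_up|].
    by move=> _ /mapP [y yY ->]; apply/up_pair/mem_up/p.
  by apply: IH => // y yY; split; [apply/ext_r/map_f|apply/ext_l/p].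
Qed.

(** A complete run of the construction: worlds and domains exhaust [V], and extension problems are
    solved by new steps as in [rich_chain]. *)
Record pchain (Zk : nat -> V -> Prop) (Yk : nat -> seq V) : Prop := PChain {
  pc_steps : forall k, psteps (Zk k) (Yk k) (Zk k.+1) (Yk k.+1);
  pc_closed : uclosed u (Zk 0);
  pc_placed : placed (Zk 0) (Yk 0);
  pc_world : forall x, exists k, Zk k x;
  pc_domain : forall x, exists k, x \in Yk k;
  pc_rich : forall k A D, strong A -> strong D -> {subset A <= D} ->
    (forall x, x \in A -> Zk k x) ->
    exists j (g : aut), [/\ k <= j, {in A, g =1 id}, free_step m u (Zk j) (map g D),
      forall x, x \in D -> Zk j (g x) -> x \in A &
      psteps (ext u (Zk j) (map g D)) (Yk j) (Zk j.+1) (Yk j.+1)] }.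

Lemma pchain_placed Zk Yk k : pchain Zk Yk -> placed (Zk k) (Yk k).
Proof.
move=> pc; elim: k => [|k IH]; first exact: pc_placed pc.
exact: psteps_placed (pc_steps pc k) IH.
Qed.

Lemma pchain_mono Zk Yk i j : pchain Zk Yk -> i <= j -> psteps (Zk i) (Yk i) (Zk j) (Yk j).
Proof.
move=> pc; elim: j => [|j IH]; first by rewrite leqn0 => /eqP ->; apply: ps_refl.
rewrite leq_eqVlt => /orP [/eqP ->|/IH s]; first exact: ps_refl.
exact: psteps_trans s (pc_steps pc j).
Qed.

(** The extensions given by [psteps_extend] along the chain have a union defined everywhere.
    Equivariance under [w] at [x] is read off at a stage whose domain contains [ab a x]. *)
Lemma pchain_live Zk Yk k : pchain Zk Yk -> live (Zk k) (Yk k).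
Proof.
move=> pc N0 f cf.
have [||fs [fs0 fsP fsR]] := @dependent_choice_nat (V -> fgraph_option N0)
    (fun j g => compatible (Zk (k + j)) (Yk (k + j)) g)
    (fun j g h => forall x, Zk (k + j) x -> h x = g x) f.
- by rewrite addn0.
- move=> j g cg; rewrite addnS.
  have [h ch hg] := psteps_extend (pc_steps pc (k + j)) (pchain_placed (k := k + j) pc) cg.
  by exists h.
have Zsub i j x : i <= j -> Zk i x -> Zk j x.
  by move=> le; apply: steps_sub (psteps_steps (pchain_mono pc le)).
have mono i j x : i <= j -> Zk (k + i) x -> fs j x = fs i x.
  move=> le Zx; elim: j le => [|j IH]; first by rewrite leqn0 => /eqP ->.
  rewrite leq_eqVlt => /orP [/eqP -> //|le]; rewrite fsR ?IH //.
  by apply: Zsub Zx; rewrite leq_add2l.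
have [n nE] := choice (pc_world pc).
have nZ x : Zk (k + n x) x by apply: Zsub (nE x); apply: leq_addl.
pose g x := fs (n x) x.
have gE j x : Zk (k + j) x -> g x = fs j x.
  move=> Zx; case: (leqP j (n x)) => [le|/ltnW le]; first by rewrite /g (mono _ _ _ le).
  by rewrite /g (mono _ _ _ le).
exists g; split=> [x Zx|[i|] x _|x y _ _ exy].
- by rewrite (gE 0) ?addn0 // fs0.
- have [ef _ _] := fsP (n x).
  have cZ : uclosed u (Zk (k + n x)).
    by apply: steps_closed (pc_closed pc); apply/psteps_steps/(pchain_mono pc).
  have Zux : Zk (k + n x) (u i x) by apply/cZ.
  by rewrite [ocons w (Some i) x]/= (gE _ _ Zux) (gE _ _ (nZ x)); apply: ef.
- have [j yY] := pc_domain pc (ab a x); set y := ab a x in yY.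
  have xE : x = a y by rewrite /y abK.
  have yY' : y \in Yk (k + j).
    by apply: psteps_subset (pchain_mono pc (leq_addl k j)) _ yY.
  have [Za Zb] := pchain_placed pc yY'.
  have [_ _ fY] := fsP j.
  by rewrite xE /= afK !(gE j) // fY.
- pose j := maxn (n x) (n y).
  have Zx : Zk (k + j) x by apply: Zsub (nZ x); rewrite leq_add2l leq_maxl.
  have Zy : Zk (k + j) y by apply: Zsub (nZ y); rewrite leq_add2l leq_maxr.
  by rewrite !(gE j) //; have [_ hf _] := fsP j; apply: hf.
Qed.

(** The initial pairs are [(c, c)] with [c] in [C]. Thus liveness of stage [0] gives the freeness of
    [w] over [C], and the sets [up (Zk k)] form a rich chain for the action enlarged by [w]. *)
Lemma pchain_generic Zk Yk C : pchain Zk Yk -> strong C ->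
  Zk 0 = clos u (mset C) -> map a (Yk 0) =i C -> {in Yk 0, a =1 b} -> generic_over C w.
Proof.
move=> pc sC Z0 aY abY.
have fixC c : c \in C -> exists2 y, y \in Yk 0 & c = a y by rewrite -aY => /mapP.
split=> //.
- by move=> c /fixC [y yY ->]; rewrite /= afK abY.
- move=> N f ef hf fC; have lv := pchain_live (k := 0) pc.
  pose f' x : fgraph_option N := Some (f x).
  have [|g [gf eg hg]] := lv N f'.
    rewrite Z0; split=> [i x Zx|x y Zx Zy exy|y yY]; first by rewrite /f' ef.
      exact: hf.
    by rewrite -abY // /f' /= fC // -aY; apply: map_f.
  rewrite Z0 in gf.
  have gS x : up (mset C) x -> exists y, g x = Some y.
    case=> wd [z [Zz ->]]; rewrite (eqvar_act wd _ eg) // gf; last exact: sub_clos.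
    by exists (act wd (f z)); rewrite act_option.
  exists (fun x => odflt (f x) (g x)); split=> [x Zx|j x Zx|x y Zx Zy exy].
  + by rewrite gf.
  + by have [y gx] := gS x Zx; rewrite eg // gx.
  + have [[x' gx] [y' gy]] := (gS x Zx, gS y Zy).
    by have := hg x y Logic.I Logic.I exy; rewrite gx gy.
- split; first exact: clos_uclosed.
  have up0 : up (Zk 0) = up (mset C).
    apply/predeqP => x; split; move: x; apply: up_sub; last first.
      by move=> x xC; apply: mem_up; rewrite Z0; apply: sub_clos.
    by rewrite Z0; apply: clos_min; [exact: up_uclosed|exact: mem_up].
  exists (fun k => up (Zk k)); last by rewrite up0; apply: steps_refl.
  have upk k : steps m (ocons w) (up (Zk k)) (up (Zk k.+1)).
    apply: psteps_up (pc_steps pc k) (pchain_placed (k := k) pc) _.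
    exact: pchain_live.
  split=> // [x|k A D sA sD AD AZ].
    by have [k Zx] := pc_world pc x; exists k; apply: mem_up.
  (* A point of [up (Zk k)] need not lie in [Zk k], so richness is invoked from a stage [l] whose
     world contains [A]. *)
  have [l [kl AZl]] : exists l, k <= l /\ forall x, x \in A -> Zk l x.
    have [n nA] := chain_finite A (fun k => psteps_steps (pc_steps pc k)) (pc_world pc).
    exists (maxn k n); split; first exact: leq_maxl.
    move=> x /nA; apply: steps_sub (psteps_steps (pchain_mono pc _)); exact: leq_maxr.
  have [j [g [lj gA fs gD ps]]] := pc_rich pc sA sD AD AZl.
  have pl : placed (Zk j) (Yk j) := pchain_placed (k := j) pc.
  have pl' : placed (ext u (Zk j) (map g D)) (Yk j).
    by move=> y yY; have [] := pl y yY; split; apply: ext_l.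
  have lv := live_psteps ps pl' (pchain_live (k := j.+1) pc).
  have [fs' DZ] := free_step_up fs pl lv.
  exists j, g; split=> //; first exact: leq_trans lj.
    by move=> x xD /(DZ _ (map_f g xD)); apply: gD.
  by rewrite up_ext; apply: psteps_up ps pl' (pchain_live (k := j.+1) pc).
Qed.

End Pairs.
End OneMore.
End GenericOver.

(** * Products of three generic automorphisms *)

Section Factorization.
Variables (m : nat) (V : countType) (e : rel V).
Hypothesis HM : is_generic m e.
Local Notation strong := (strong e m).
Local Notation aut := (aut e).
Implicit Types (Z S : V -> Prop) (D A B C T Y : seq V).
Variables (I : Type) (u : I -> aut).
Local Notation mset C := (fun x => x \in (C : seq V)).
Local Notation good := (good m u).
Local Notation psteps := (psteps m u).

Lemma psteps_sym (a b : aut) Z Y Z' Y' : psteps a b Z Y Z' Y' -> psteps b a Z Y Z' Y'.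
Proof.
elim=> {Z Y Z' Y'} [Z Y|Z Y D Z' Y' fs _ IH|Z Y Y1 Z' Y' s p fs d _ IH|Z Y Y1 Z' Y' s p fs d _ IH].
- exact: ps_refl.
- exact: ps_new fs IH.
- exact: ps_preimage s p fs d IH.
- exact: ps_image s p fs d IH.
Qed.

(** Only values on the final domain enter, so limit automorphisms may replace those of a finite
    stage. *)
Lemma psteps_congr (a b a' b' : aut) Z Y Z' Y' : {in Y', a =1 a'} -> {in Y', b =1 b'} ->
  psteps a b Z Y Z' Y' -> psteps a' b' Z Y Z' Y'.
Proof.
move=> aE bE s; elim: s aE bE => {Z Y Z' Y'} [Z Y|Z Y D Z' Y' fs _ IH|
  Z Y Y1 Z' Y' s p fs d ps IH|Z Y Y1 Z' Y' s p fs d ps IH] aE bE.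
- exact: ps_refl.
- exact: ps_new fs (IH aE bE).
- have sY := psteps_subset ps.
  have E : map b Y1 = map b' Y1 by apply/eq_in_map => y /sY; apply: bE.
  rewrite E in fs IH; apply: ps_image s _ fs _ (IH aE bE) => y yY.
    by rewrite -aE; [apply: p|apply: sY].
  by rewrite -bE; [apply: d|apply: sY].
- have sY := psteps_subset ps.
  have E : map a Y1 = map a' Y1 by apply/eq_in_map => y /sY; apply: aE.
  rewrite E in fs IH; apply: ps_preimage s _ fs _ (IH aE bE) => y yY.
    by rewrite -bE; [apply: p|apply: sY].
  by rewrite -aE; [apply: d|apply: sY].
Qed.

Lemma fresh_copy Z Y Y' (a : aut) : good Z -> strong Y -> strong Y' -> {subset Y <= Y'} ->
  (forall y, y \in Y -> Z (a y)) ->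
  exists a' : aut, [/\ {in Y, a' =1 a}, free_step m u Z (map a' Y'),
    forall y, y \in Y' -> Z (a' y) -> y \in Y & good (ext u Z (map a' Y'))].
Proof.
move=> gZ sY sY' YY' aZ.
have [||g [gA fs gD gZ']] := good_ext gZ (strong_map a sY) (strong_map a sY').
- by move=> x; rewrite !mem_map_autV => /YY'.
- by move=> _ /mapP [y yY ->]; apply: aZ.
exists (acomp g a); rewrite -map_comp in fs gZ'; split=> //.
- by move=> y yY /=; rewrite gA //; apply: map_f.
- by move=> y yY' /(gD (a y)); rewrite !mem_map_aut; apply.
Qed.

Lemma fresh_image Z Y Y' (a b : aut) : free_step m u Z (map b Y') ->
  (forall y, y \in Y' -> Z (b y) -> y \in Y) -> {subset Y <= Y'} ->
  (forall y, y \in Y' -> Z (a y)) -> psteps a b Z Y (ext u Z (map b Y')) Y'.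
Proof. by move=> fs d s p; apply: ps_image s p fs d (ps_refl _ _ _ _ _ _). Qed.

Definition task (k : nat) : option (seq V * seq V) := unpickle (target k).

Lemma task_infinite A D k : exists2 j, k <= j & task j = Some (A, D).
Proof.
have [j kj tj] := target_infinite (pickle (A, D)) k.
by exists j => //; rewrite /task tj pickleK.
Qed.

(** A scheduled pair that is no extension problem over [Z] leaves [Z] as it is; as every pair recurs
    in the schedule, no problem is missed. *)
Lemma good_task Z t : good Z -> exists Z', [/\ good Z', steps m u Z Z' &
  forall A D, t = Some (A, D) -> strong A -> strong D -> {subset A <= D} ->
    (forall x, x \in A -> Z x) -> exists g : aut, [/\ {in A, g =1 id},
      free_step m u Z (map g D), forall x, x \in D -> Z (g x) -> x \in A &
      Z' = ext u Z (map g D)]].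
Proof.
move=> gZ.
case: (pselect (exists A D, [/\ t = Some (A, D), strong A, strong D, {subset A <= D} &
    forall x, x \in A -> Z x])) => [[A [D [tE sA sD AD AZ]]]|nP].
  have [g [gA fs gD gZ']] := good_ext gZ sA sD AD AZ.
  exists (ext u Z (map g D)); split=> // [|A' D']; first exact: steps_one.
  by rewrite tE => -[<- <-] *; exists g.
exists Z; split=> // [|A D tE sA sD AD AZ]; first exact: steps_refl.
by case: nP; exists A, D.
Qed.

Section ThreeFactors.
Variables (g : aut) (C : seq V).

(* The factors are [pos1 pos0^-1], [pos2 pos1^-1] and [(g pos0) pos2^-1]. In each round one
   position is prescribed, and of any two positions joined by a factor at least one receives a
   free copy after the other one has been placed; [g] makes [pos0] and [pos3] dependent. *)
Record position := Position {
  pos_world : V -> Prop; pos_dom : seq V; pos0 : aut; pos1 : aut; pos2 : aut }.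
Implicit Types s t : position.
Definition pos3 s := acomp g (pos0 s).

Definition pos_inv s := [/\ good (pos_world s), strong (pos_dom s) &
  forall y, y \in pos_dom s -> [/\ pos_world s (pos0 s y), pos_world s (pos1 s y),
    pos_world s (pos2 s y) & pos_world s (pos3 s y)]].

(** The three factors share their worlds and domains. The steps mention the later positions, since
    these already carry the newly decided values. *)
Definition advance s t := [/\ {subset pos_dom s <= pos_dom t},
  {in pos_dom s, forall y, [/\ pos0 t y = pos0 s y, pos1 t y = pos1 s y & pos2 t y = pos2 s y]},
  psteps (pos0 t) (pos1 t) (pos_world s) (pos_dom s) (pos_world t) (pos_dom t),
  psteps (pos1 t) (pos2 t) (pos_world s) (pos_dom s) (pos_world t) (pos_dom t) &
  psteps (pos2 t) (pos3 t) (pos_world s) (pos_dom s) (pos_world t) (pos_dom t)].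

Lemma advance_trans s1 s2 s3 : advance s1 s2 -> advance s2 s3 -> advance s1 s3.
Proof.
move=> [s12 a12 p12 q12 r12] [s23 a23 p23 q23 r23]; split.
- by move=> y /s12 /s23.
- move=> y y1; have [-> -> ->] := a23 y (s12 y y1); exact: a12.
- by apply: psteps_trans p23; apply: psteps_congr p12 => y /a23 [].
- by apply: psteps_trans q23; apply: psteps_congr q12 => y /a23 [].
- apply: psteps_trans r23; apply: psteps_congr r12 => y /a23 [] // E _ _.
  by rewrite /pos3 /= E.
Qed.

(** Prescribing [pos0] prescribes [pos3] too. Both enter the world first, then [pos1] is freely
    copied, and last [pos2], free over both its neighbours [pos1] and [pos3]. *)
Lemma advance_pos0 s B : pos_inv s -> exists t, [/\ pos_inv t, advance s t,
  {subset B <= pos_dom t} & {subset B <= map (pos0 t) (pos_dom t)}].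
Proof.
case: s => Z Y p0 p1 p2 [/= gZ sY YZ].
have [Y' sY' YY'] := strong_hull HM (Y ++ B ++ map (ab p0) B).
have {}YY' : [/\ {subset Y <= Y'}, {subset B <= Y'} & {subset B <= map p0 Y'}].
  split=> y yY; try by apply: YY'; rewrite !mem_cat yY ?orbT.
  by rewrite mem_map_autV; apply: YY'; rewrite !mem_cat map_f ?orbT.
case: YY' => YY' BY' Bp0.
have [Za [sa gZa Ya]] := good_reach (map p0 Y' ++ map (acomp g p0) Y') gZ.
have inZ (x : V) : Z x -> Za x by apply: steps_sub sa.
have [|p1' [p1E fs1 d1 gZb]] := @fresh_copy Za Y Y' p1 gZa sY sY' YY'.
  by move=> y /YZ [_ /inZ].
set Zb := ext u Za _ in gZb; have inZb (x : V) : Za x -> Zb x by apply: ext_l.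
have [|p2' [p2E fs2 d2 gZc]] := @fresh_copy Zb Y Y' p2 gZb sY sY' YY'.
  by move=> y /YZ [_ _ /inZ /inZb].
set Zc := ext u Zb _ in gZc; have inZc (x : V) : Zb x -> Zc x by apply: ext_l.
have p0Y y : y \in Y' -> Za (p0 y) by move=> yY; apply: Ya; rewrite mem_cat map_f.
have p3Y y : y \in Y' -> Za (g (p0 y)).
  by move=> yY; apply: Ya; rewrite mem_cat (map_f (acomp g p0)) ?orbT.
have p1Y y : y \in Y' -> Zb (p1' y) by move=> yY; apply/ext_r/map_f.
exists (Position Zc Y' p0 p1' p2'); split=> //=.
  split=> // y yY /=; split; [by apply/inZc/inZb/p0Y|by apply/inZc/p1Y|
    by apply/ext_r/map_f|by apply/inZc/inZb/p3Y].
split=> //= [y yY|||].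
- by rewrite p1E ?p2E.
- apply: psteps_trans (steps_psteps _ _ _ sa) _.
  apply: psteps_trans (fresh_image fs1 d1 YY' p0Y) _.
  by apply/steps_psteps/steps_one.
- apply: psteps_trans (steps_psteps _ _ _ (steps_trans sa (steps_one fs1))) _.
  exact: fresh_image fs2 d2 YY' p1Y.
- apply/psteps_sym/(psteps_trans (steps_psteps _ _ _ (steps_trans sa (steps_one fs1)))).
  by apply: fresh_image fs2 d2 YY' _ => y yY; apply/inZb/p3Y.
Qed.

(** With [pos1] prescribed, [pos0] is chosen freely over it; the values of [pos3] that this
    determines enter the world before [pos2] is chosen freely over [pos1] and [pos3]. *)
Lemma advance_pos1 s B : pos_inv s -> exists t, [/\ pos_inv t, advance s t &
  {subset B <= map (pos1 t) (pos_dom t)}].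
Proof.
case: s => Z Y p0 p1 p2 [/= gZ sY YZ].
have [Y' sY' YY'] := strong_hull HM (Y ++ map (ab p1) B).
have {}YY' : {subset Y <= Y'} /\ {subset B <= map p1 Y'}.
  split=> y yY; first by apply: YY'; rewrite !mem_cat yY.
  by rewrite mem_map_autV; apply: YY'; rewrite !mem_cat map_f ?orbT.
case: YY' => YY' Bp1.
have [Za [sa gZa Ya]] := good_reach (map p1 Y') gZ.
have inZ (x : V) : Z x -> Za x by apply: steps_sub sa.
have [|p0' [p0E fs0 d0 gZb]] := @fresh_copy Za Y Y' p0 gZa sY sY' YY'.
  by move=> y /YZ [/inZ].
set Zb := ext u Za _ in gZb; have inZb (x : V) : Za x -> Zb x by apply: ext_l.
have [Zc [sc gZc Yc]] := good_reach (map (acomp g p0') Y') gZb.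
have inZc (x : V) : Zb x -> Zc x by apply: steps_sub sc.
have [|p2' [p2E fs2 d2 gZd]] := @fresh_copy Zc Y Y' p2 gZc sY sY' YY'.
  by move=> y /YZ [_ _ /inZ /inZb /inZc].
set Zd := ext u Zc _ in gZd; have inZd (x : V) : Zc x -> Zd x by apply: ext_l.
have p1Y y : y \in Y' -> Za (p1 y) by move=> yY; apply: Ya; rewrite map_f.
have p0Y y : y \in Y' -> Zb (p0' y) by move=> yY; apply/ext_r/map_f.
have p3Y y : y \in Y' -> Zc (g (p0' y)) by move=> yY; apply: Yc; rewrite (map_f (acomp g p0')).
have sc' := steps_trans sa (steps_trans (steps_one fs0) sc).
exists (Position Zd Y' p0' p1 p2'); split=> //=.
  split=> // y yY /=; split; [by apply/inZd/inZc/p0Y|by apply/inZd/inZc/inZb/p1Y|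
    by apply/ext_r/map_f|by apply/inZd/p3Y].
split=> //= [y yY|||].
- by rewrite p0E ?p2E.
- apply: psteps_trans (steps_psteps _ _ _ sa) _.
  apply: psteps_trans (psteps_sym (fresh_image fs0 d0 YY' p1Y)) _.
  by apply: steps_psteps; apply: steps_trans sc (steps_one fs2).
- apply: psteps_trans (steps_psteps _ _ _ sc') _.
  by apply: fresh_image fs2 d2 YY' _ => y yY; apply/inZc/inZb/p1Y.
- apply/psteps_sym/(psteps_trans (steps_psteps _ _ _ sc')).
  by apply: fresh_image fs2 d2 YY' _ => y yY; apply: p3Y.
Qed.

(** With [pos2] prescribed, it is [pos3] that receives the free copy; [pos0] is recovered through
    the inverse of [g] and placed before [pos1] is chosen freely over [pos0] and [pos2]. *)
Lemma advance_pos2 s B : pos_inv s -> exists t, [/\ pos_inv t, advance s t &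
  {subset B <= map (pos2 t) (pos_dom t)}].
Proof.
case: s => Z Y p0 p1 p2 [/= gZ sY YZ].
have [Y' sY' YY'] := strong_hull HM (Y ++ map (ab p2) B).
have {}YY' : {subset Y <= Y'} /\ {subset B <= map p2 Y'}.
  split=> y yY; first by apply: YY'; rewrite !mem_cat yY.
  by rewrite mem_map_autV; apply: YY'; rewrite !mem_cat map_f ?orbT.
case: YY' => YY' Bp2.
have [Za [sa gZa Ya]] := good_reach (map p2 Y') gZ.
have inZ (x : V) : Z x -> Za x by apply: steps_sub sa.
have [|p3' [p3E fs3 d3 gZb]] := @fresh_copy Za Y Y' (acomp g p0) gZa sY sY' YY'.
  by move=> y /YZ [_ _ _ /inZ].
set Zb := ext u Za _ in gZb; have inZb (x : V) : Za x -> Zb x by apply: ext_l.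
pose p0' := acomp (ainv g) p3'.
have [Zc [sc gZc Yc]] := good_reach (map p0' Y') gZb.
have inZc (x : V) : Zb x -> Zc x by apply: steps_sub sc.
have [|p1' [p1E fs1 d1 gZd]] := @fresh_copy Zc Y Y' p1 gZc sY sY' YY'.
  by move=> y /YZ [_ /inZ /inZb /inZc].
set Zd := ext u Zc _ in gZd; have inZd (x : V) : Zc x -> Zd x by apply: ext_l.
have p2Y y : y \in Y' -> Za (p2 y) by move=> yY; apply: Ya; rewrite map_f.
have p3Y y : y \in Y' -> Zb (p3' y) by move=> yY; apply/ext_r/map_f.
have p0Y y : y \in Y' -> Zc (p0' y) by move=> yY; apply: Yc; rewrite map_f.
have g0E y : g (p0' y) = p3' y by rewrite /= abK.
have sc' := steps_trans sa (steps_trans (steps_one fs3) sc).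
exists (Position Zd Y' p0' p1' p2); split=> //=.
  split=> // y yY /=; split; [by apply/inZd/p0Y|by apply/ext_r/map_f|
    by apply/inZd/inZc/inZb/p2Y|by rewrite abK; apply/inZd/inZc/p3Y].
split=> //= [y yY|||].
- by rewrite p1E ?p3E //= afK.
- apply: psteps_trans (steps_psteps _ _ _ sc') _.
  exact: fresh_image fs1 d1 YY' p0Y.
- apply/psteps_sym/(psteps_trans (steps_psteps _ _ _ sc')).
  by apply: fresh_image fs1 d1 YY' _ => y yY; apply/inZc/inZb/p2Y.
- apply: (@psteps_congr p2 p3') => // [y _|]; first by rewrite /= abK.
  apply: psteps_trans (steps_psteps _ _ _ sa) _.
  apply: psteps_trans (fresh_image fs3 d3 YY' p2Y) _.
  by apply: steps_psteps; apply: steps_trans sc (steps_one fs1).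
Qed.

Hypotheses (sC : strong C) (gC : good (clos u (mset C))) (gfix : {in C, g =1 id}).

(** Each round treats one extension problem and then prescribes [pos0], [pos1] and [pos2] in turn,
    so that their limits are onto. Consecutive limits form a [pchain] each, and the product of the
    quotients telescopes to [a3 a0^-1], which is [g]. *)
Theorem three_factors : exists w1 w2 w3 : aut,
  [/\ generic_over m u C w1, generic_over m u C w2, generic_over m u C w3 &
      forall x, g x = w1 (w2 (w3 x))].
Proof.
pose s0 := Position (clos u (mset C)) C (aid e) (aid e) (aid e).
pose P (k : nat) s := pos_inv s.
pose R (k : nat) s t := [/\ advance s t,
  [/\ {subset first_points V k <= pos_dom t},
      {subset first_points V k <= map (pos0 t) (pos_dom t)},
      {subset first_points V k <= map (pos1 t) (pos_dom t)} &
      {subset first_points V k <= map (pos2 t) (pos_dom t)}] &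
  forall A D, task k = Some (A, D) -> strong A -> strong D -> {subset A <= D} ->
    (forall x, x \in A -> pos_world s x) -> exists h : aut, [/\ {in A, h =1 id},
      free_step m u (pos_world s) (map h D),
      forall x, x \in D -> pos_world s (h x) -> x \in A &
      advance (Position (ext u (pos_world s) (map h D)) (pos_dom s) (pos0 s) (pos1 s) (pos2 s)) t]].
have [||s [sE sP sR]] := @dependent_choice_nat position P R s0.
- split=> //= y yC; rewrite gfix //.
  by split; apply: sub_clos.
- move=> k s [gZ sY YZ]; have [Z1 [gZ1 st1 tk]] := good_task (task k) gZ.
  pose s1 := Position Z1 (pos_dom s) (pos0 s) (pos1 s) (pos2 s).
  have inZ (x : V) : pos_world s x -> Z1 x by apply: steps_sub st1.
  have inv1 : pos_inv s1.
    by split=> //= y /YZ [y0 y1 y2 y3]; split; apply: inZ.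
  have [s2 [inv2 adv12 B2 B2']] := advance_pos0 (first_points V k) inv1.
  have [s3 [inv3 adv23 B3]] := advance_pos1 (first_points V k) inv2.
  have [s4 [inv4 adv34 B4]] := advance_pos2 (first_points V k) inv3.
  have adv14 := advance_trans adv12 (advance_trans adv23 adv34).
  have mapsub (t t' : position) (p : position -> aut) B :
      {in pos_dom t, p t' =1 p t} -> {subset pos_dom t <= pos_dom t'} ->
      {subset B <= map (p t) (pos_dom t)} -> {subset B <= map (p t') (pos_dom t')}.
    by move=> E sub BB x /BB /mapP [y yt ->]; rewrite -E //; apply/map_f/sub.
  exists s4; split=> //; split.
  + case: adv14 => sub14 a14 p14 q14 r14; split=> //.
    * exact: psteps_trans (steps_psteps _ _ _ st1) p14.
    * exact: psteps_trans (steps_psteps _ _ _ st1) q14.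
    * exact: psteps_trans (steps_psteps _ _ _ st1) r14.
  + have adv24 := advance_trans adv23 adv34.
    case: adv24 => sub24 a24 _ _ _; case: adv34 => sub34 a34 _ _ _; split=> //.
    * by move=> x /B2 /sub24.
    * by apply: (mapsub s2 s4 pos0) => // y /a24 [].
    * by apply: (mapsub s3 s4 pos1) => // y /a34 [].
  + move=> A D tE sA sD AD AZ; have [h [hA fs hD E]] := tk A D tE sA sD AD AZ.
    by exists h; rewrite -E.
have Ysub k : {subset pos_dom (s k) <= pos_dom (s k.+1)} by case: (sR k) => -[].
have YV x : exists k, x \in pos_dom (s k).
  (* A vertex lies in [first_points V k] once [k] exceeds its code, and [R k] places it at stage
     [k.+1]; hence the shift by two. *)
  by exists (pickle x).+2; case: (sR (pickle x).+1) => _ [H _ _ _] _; apply/H/mem_first_points.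
have lim (p : position -> aut) :
    (forall k, {in pos_dom (s k), p (s k.+1) =1 p (s k)}) ->
    (forall k, {subset first_points V k <= map (p (s k.+1)) (pos_dom (s k.+1))}) ->
    exists a : aut, forall k, {in pos_dom (s k), a =1 p (s k)}.
  move=> E sub; apply: aut_limit => // x; exists (pickle x).+2.
  by apply/sub/mem_first_points.
have [|k|a0 a0E] := lim pos0; [by move=> k y yY; case: (sR k) => -[_ /(_ y yY) []]|
  by case: (sR k) => _ []|].
have [|k|a1 a1E] := lim pos1; [by move=> k y yY; case: (sR k) => -[_ /(_ y yY) []]|
  by case: (sR k) => _ []|].
have [|k|a2 a2E] := lim pos2; [by move=> k y yY; case: (sR k) => -[_ /(_ y yY) []]|
  by case: (sR k) => _ []|].
pose a3 := acomp g a0.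
have a3E k : {in pos_dom (s k), a3 =1 pos3 (s k)} by move=> y yY; rewrite /= (a0E k).
have chain (a b : aut) (p q : position -> aut) :
    (forall k, {in pos_dom (s k), a =1 p (s k)}) -> (forall k, {in pos_dom (s k), b =1 q (s k)}) ->
    (forall t t', advance t t' ->
      psteps (p t') (q t') (pos_world t) (pos_dom t) (pos_world t') (pos_dom t')) ->
    (forall t y, pos_inv t -> y \in pos_dom t -> pos_world t (p t y) /\ pos_world t (q t y)) ->
    pchain m u a b (fun k => pos_world (s k)) (fun k => pos_dom (s k)).
  move=> aE bE pq pl.
  have psE t k : psteps (p (s k)) (q (s k)) (pos_world t) (pos_dom t) (pos_world (s k)) (pos_dom (s k)) ->
      psteps a b (pos_world t) (pos_dom t) (pos_world (s k)) (pos_dom (s k)).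
    by apply: psteps_congr => y yY; rewrite ?(aE k) ?(bE k).
  split=> //.
  - by move=> k; apply: (psE (s k)); apply: pq; case: (sR k).
  - by case: (sP 0) => -[].
  - by move=> y yY; rewrite (aE 0) // (bE 0) //; apply: pl (sP 0) yY.
  - move=> x; have [k xk] := YV (ab a x); exists k.
    by have [H _] := pl _ _ (sP k) xk; move: H; rewrite -(aE k) // abK.
  - move=> k A D sA sD AD AZ; have [j kj tE] := task_infinite A D k.
    have AZj x : x \in A -> pos_world (s j) x.
      move=> /AZ; apply: steps_sub; apply: (@chain_steps _ _ _ _ u (fun k => pos_world (s k))) => // i.
      by case: (sR i) => -[_ _ ps _ _] _ _; apply: psteps_steps ps.
    have [_ _ /(_ A D tE sA sD AD AZj) [h [hA fs hD adv]]] := sR j.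
    exists j, h; split=> //.
    exact: (psE (Position (ext u (pos_world (s j)) (map h D)) (pos_dom (s j))
      (pos0 (s j)) (pos1 (s j)) (pos2 (s j)))) (pq _ _ adv).
have c01 : pchain m u a0 a1 (fun k => pos_world (s k)) (fun k => pos_dom (s k)).
  by apply: (chain a0 a1 pos0 pos1) => // [t t' []|t y [_ _ /[apply]] []].
have c12 : pchain m u a1 a2 (fun k => pos_world (s k)) (fun k => pos_dom (s k)).
  by apply: (chain a1 a2 pos1 pos2) => // [t t' []|t y [_ _ /[apply]] []].
have c23 : pchain m u a2 a3 (fun k => pos_world (s k)) (fun k => pos_dom (s k)).
  by apply: (chain a2 a3 pos2 pos3) => // [t t' []|t y [_ _ /[apply]] []].
have aC (a : aut) (p : position -> aut) : (forall k, {in pos_dom (s k), a =1 p (s k)}) ->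
    p s0 = aid e -> {in C, a =1 id}.
  by move=> aE E c cC; have := aE 0 c; rewrite sE E /=; apply.
have a0C := aC _ _ a0E erefl; have a1C := aC _ _ a1E erefl; have a2C := aC _ _ a2E erefl.
have a3C : {in C, a3 =1 id} by move=> c cC; rewrite /= a0C ?gfix.
have fin (a b : aut) : pchain m u a b (fun k => pos_world (s k)) (fun k => pos_dom (s k)) ->
    {in C, a =1 id} -> {in C, b =1 id} -> generic_over m u C (acomp b (ainv a)).
  move=> pc aid' bid; apply: (pchain_generic pc) => //; rewrite sE //=.
    by move=> x; apply/mapP/idP => [[c cC ->]|xC]; [rewrite aid'|exists x; rewrite ?aid'].
  by move=> c cC; rewrite aid' ?bid.
exists (acomp a3 (ainv a2)), (acomp a2 (ainv a1)), (acomp a1 (ainv a0)).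
by split; [exact: fin|exact: fin|exact: fin|move=> x /=; rewrite !afK abK].
Qed.

End ThreeFactors.
End Factorization.

(** * Scheduling the splittings of a perfect binary tree *)

Section Branches.
Implicit Types (s t : nat -> bool).

(* The leaf followed by the branch [s] and its depth: at time [k] the leaf [target k] splits,
   and the branches whose next bit is set move to the new leaf [k.+1]. *)
Fixpoint branch s k : nat * nat :=
  if k is k'.+1 then
    let: (i, d) := branch s k' in
    if i == target k' then (if s d then k'.+1 else i, d.+1) else (i, d)
  else (0, 0).

Definition leaf s k := (branch s k).1.
Definition depth s k := (branch s k).2.

Lemma leafS s k : leaf s k.+1 =
  if (leaf s k == target k) && s (depth s k) then k.+1 else leaf s k.
Proof. by rewrite /leaf /depth /=; case: (branch s k) => i d /=; case: eqP => //; case: (s d). Qed.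

Lemma depthS s k : depth s k.+1 =
  if leaf s k == target k then (depth s k).+1 else depth s k.
Proof. by rewrite /leaf /depth /=; case: (branch s k) => i d /=; case: eqP. Qed.

Lemma leaf_le s k : leaf s k <= k.
Proof.
elim: k => // k IH; rewrite leafS; case: ifP => // _; exact: leqW.
Qed.

(** A leaf created at time [k] has number [k.+1], larger than all leaves in use then; hence branches
    on a common leaf were never apart before and have advanced together. *)
Lemma leaf_depth s t k : leaf s k = leaf t k -> depth s k = depth t k.
Proof.
elim: k => // k IH; rewrite !leafS !depthS.
have := leaf_le s k; have := leaf_le t k; have := target_le k.
case: eqP => [ls|ls]; case: eqP => [lt|lt] /=.
- by move=> _ _ _ _; rewrite IH // ls lt.
- by case: (s _) => //= *; lia.
- by case: (t _) => //= *; lia.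
- by move=> _ _ _ /IH.
Qed.

Lemma leaf_next s k : exists j, [/\ k <= j, leaf s j = target j, leaf s j = leaf s k &
  depth s j = depth s k].
Proof.
have ex : exists j, (k <= j) && (leaf s j == target j).
  apply: contrapT => nE; have const j : leaf s (k + j) = leaf s k.
    elim: j => [|j IH]; first by rewrite addn0.
    rewrite addnS leafS IH; case: eqP => // E; case: nE; exists (k + j).
    by rewrite leq_addr IH E eqxx.
  have [j kj tj] := target_infinite (leaf s k) k; apply: nE; exists j.
  by rewrite kj tj -(subnKC kj) const eqxx.
case: (ex_minnP ex) => j /andP [kj /eqP tj] min; exists j.
suff const i : i <= j - k -> leaf s (k + i) = leaf s k /\ depth s (k + i) = depth s k.
  by have := const (j - k) (leqnn _); rewrite subnKC // => -[lj dj].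
elim: i => [|i IH] le; first by rewrite addn0.
have [IH1 IH2] := IH (ltnW le); rewrite addnS leafS depthS.
case: eqP => // E; have := min (k + i); rewrite leq_addr E eqxx => /(_ isT); lia.
Qed.

Lemma leaf_depth_onto s n : exists k, leaf s k = target k /\ depth s k = n.
Proof.
elim: n => [|n [k [lk dk]]].
  by have [j [_ lj _ dj]] := leaf_next s 0; exists j.
by have [j [_ lj _ dj]] := leaf_next s k.+1; exists j; rewrite dj depthS lk eqxx dk.
Qed.

(** If the leaves always agreed, both branches would read every bit at the same time and with the
    same outcome. Just before the first difference, the shared leaf must be the one that splits. *)
Lemma leaf_separate s t : s <> t -> exists k,
  [/\ leaf s k = target k, leaf t k = target k & leaf s k.+1 <> leaf t k.+1].
Proof.
move=> st; have ex : exists k, leaf s k != leaf t k.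
  apply: contrapT => nE; apply: st; apply/funext => n.
  have eqst k : leaf s k = leaf t k.
    by apply: contrapT => E; apply: nE; exists k; apply/eqP.
  have [k [lk dk]] := leaf_depth_onto s n.
  have dk' : depth t k = n by rewrite -(leaf_depth (eqst k)).
  have := eqst k.+1; have := target_le k; rewrite !leafS -(eqst k) lk eqxx dk dk' /=.
  by case: (s n); case: (t n) => //; lia.
case: (ex_minnP ex) => -[|k]; first by rewrite eqxx.
move=> ne min; have E : leaf s k = leaf t k.
  by apply/eqP/negPn/negP => /min; rewrite ltnn.
exists k; suff lk : leaf s k = target k by rewrite -E; split=> //; apply/eqP.
apply/eqP/negPn/negP => nt; case/negP: ne.
by rewrite !leafS -E (negbTE nt) E.
Qed.

Lemma leaf_apart s t j k : j <= k -> leaf s j <> leaf t j -> leaf s k <> leaf t k.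
Proof.
elim: k => [|k IH]; first by rewrite leqn0 => /eqP ->.
rewrite leq_eqVlt => /orP [/eqP -> //|jk] ne; have {IH} := IH jk ne.
have := leaf_le s k; have := leaf_le t k; rewrite !leafS.
by do 2 case: ifP => [/andP [/eqP ? _]|_]; lia.
Qed.

End Branches.

(** * A perfect family of generic quotients *)

Section PerfectFamily.
Variables (m : nat) (V : countType) (e : rel V).
Hypothesis HM : is_generic m e.
Local Notation strong := (strong e m).
Local Notation aut := (aut e).
Implicit Types (Z S : V -> Prop) (D A C T Y : seq V).
Variables (I : Type) (u : I -> aut).
Local Notation mset C := (fun x => x \in (C : seq V)).
Local Notation good := (good m u).
Local Notation psteps := (psteps m u).

(** The copies are added one after the other, each free over the earlier ones. For two of them the
    later is a free image of the earlier, and [psteps_sym] covers the other order. *)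
Lemma fresh_copies Z Y Y' (p : nat -> aut) (L : seq nat) : good Z -> strong Y -> strong Y' ->
  {subset Y <= Y'} -> uniq L -> (forall j y, j \in L -> y \in Y -> Z (p j y)) ->
  exists (p' : nat -> aut) Z', [/\ good Z', steps m u Z Z',
    [/\ forall j, j \notin L -> p' j = p j, forall j, j \in L -> {in Y, p' j =1 p j} &
        forall j y, j \in L -> y \in Y' -> Z' (p' j y)],
    forall (b : aut), (forall y, y \in Y' -> Z (b y)) ->
      forall j, j \in L -> psteps b (p' j) Z Y Z' Y' &
    forall i j, i \in L -> j \in L -> i != j -> psteps (p' i) (p' j) Z Y Z' Y'].
Proof.
move=> gZ sY sY' YY'; elim: L Z gZ p => [|i L IH] Z gZ p /= => [_ _|/andP [iL uL] pZ].
  by exists p, Z; split=> //; apply: steps_refl.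
have [|a [aE fs ad gZ1]] := @fresh_copy _ _ _ _ u Z Y Y' (p i) gZ sY sY' YY'.
  by move=> y; apply: pZ; rewrite mem_head.
set Z1 := ext u Z _ in gZ1.
pose p1 j := if j == i then a else p j.
have [|p' [Z' [gZ' st [pN pE pZ'] pb pp]]] := IH Z1 gZ1 p1 uL.
  move=> j y jL yY; rewrite /p1; case: eqP jL => [->|_ jL]; first by rewrite (negbTE iL).
  by apply/ext_l/pZ => //; rewrite inE jL orbT.
have p'i : p' i = a by rewrite pN // /p1 eqxx.
have aZ1 y : y \in Y' -> Z1 (a y) by move=> yY; apply/ext_r/map_f.
have stZ1 : steps m u Z Z1 := steps_one fs.
have first (b : aut) : (forall y, y \in Y' -> Z (b y)) -> psteps b a Z Y Z' Y'.
  move=> bZ; apply: psteps_trans (fresh_image fs ad YY' bZ) _.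
  exact: steps_psteps.
have later (b : aut) j : (forall y, y \in Y' -> Z1 (b y)) -> j \in L -> psteps b (p' j) Z Y Z' Y'.
  by move=> bZ jL; apply: psteps_trans (steps_psteps _ _ _ stZ1) (pb b bZ j jL).
exists p', Z'; split=> //.
- exact: steps_trans stZ1 st.
- split=> [j|j|j y].
  + by rewrite inE negb_or => /andP [/negbTE ji jL]; rewrite pN // /p1 ji.
  + rewrite inE => /orP [/eqP ->|jL]; first by rewrite p'i.
    move=> y yY; rewrite pE // /p1; case: eqP jL => // ->.
    by rewrite (negbTE iL).
  + rewrite inE => /orP [/eqP -> yY|]; last exact: pZ'.
    by rewrite p'i; apply: steps_sub st _; apply: aZ1.
- move=> b bZ j; rewrite inE => /orP [/eqP ->|jL]; first by rewrite p'i; apply: first.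
  by apply: later => // y yY; apply/ext_l/bZ.
- move=> j k; rewrite !inE => /orP [/eqP ->|jL] /orP [/eqP ->|kL] ne.
  + by rewrite eqxx in ne.
  + by rewrite p'i; apply: later.
  + by rewrite p'i; apply/psteps_sym/later.
  + exact: psteps_trans (steps_psteps _ _ _ stZ1) (pp j k jL kL ne).
Qed.

Record leaves := Leaves { lv_world : V -> Prop; lv_dom : seq V; lv_pos : nat -> aut }.

(** In round [k] the leaf [target k] is prescribed, all other leaves get free copies over it and
    over each other, and the new leaf [k.+1] starts as a duplicate of [target k]. When two branches
    part, both positions map the current domain onto the same strong set [C] in the same way, and
    from then on their pair runs through a [pchain] over [C]. *)
Theorem perfect_family (C0 B : seq V) : good (clos u (mset C0)) ->
  exists p : (nat -> bool) -> aut, forall s t, s <> t ->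
    exists C, [/\ {subset B <= C}, good (clos u (mset C)) &
      generic_over m u C (acomp (p s) (ainv (p t)))].
Proof.
move=> gC0.
pose P (k : nat) (s : leaves) := [/\ good (lv_world s), fingen u (lv_world s), strong (lv_dom s) &
  forall j y, j <= k -> y \in lv_dom s -> lv_world s (lv_pos s j y)].
pose pairs (k : nat) Z (s t : leaves) := forall i j, i <= k -> j <= k -> i != j ->
  psteps (lv_pos t i) (lv_pos t j) Z (lv_dom s) (lv_world t) (lv_dom t).
pose R (k : nat) (s t : leaves) := [/\
  [/\ {subset lv_dom s <= lv_dom t}, steps m u (lv_world s) (lv_world t) &
    forall j, j <= k -> {in lv_dom s, lv_pos t j =1 lv_pos s j}],
  lv_pos t k.+1 = lv_pos t (target k) /\ pairs k (lv_world s) s t,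
  {subset first_points V k <= lv_dom t} /\
    {subset first_points V k <= map (lv_pos t (target k)) (lv_dom t)},
  exists C, [/\ strong C, {subset B <= C}, map (lv_pos t (target k)) (lv_dom t) =i C,
    good (clos u (mset C)) & steps m u (clos u (mset C)) (lv_world t)] &
  forall A D, task V k = Some (A, D) -> strong A -> strong D -> {subset A <= D} ->
    (forall x, x \in A -> lv_world s x) -> exists h : aut, [/\ {in A, h =1 id},
      free_step m u (lv_world s) (map h D),
      forall x, x \in D -> lv_world s (h x) -> x \in A &
      pairs k (ext u (lv_world s) (map h D)) s t]].
have [||s [s0 sP sR]] := @dependent_choice_nat leaves P R
    (Leaves (clos u (mset C0)) [::] (fun _ => aid e)).
- by split=> //; [exists C0|exact: strong_nil].
- move=> k [Z Y p] [/= gZ fZ sY pZ].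
  have [Z1 [gZ1 st1 tk]] := good_task (task V k) gZ.
  pose i := target k; pose X := first_points V k.
  (* [C] becomes the image of the new domain [Y'] under [p i]; its three parts ensure that it
     contains [B], that [Y'] contains [Y] and [X], and that the range contains [X]. *)
  have [C [sC BC gC stC]] := good_reach_strong HM (B ++ map (p i) (Y ++ X) ++ X) gZ1
    (steps_fingen st1 fZ).
  set Z2 := clos u _ in gC stC; pose Y' := map (ainv (p i)) C.
  have sY' : strong Y' by apply: strong_map.
  have memY' y : (y \in Y') = (p i y \in C) by rewrite mem_map_autV.
  have YY' : {subset Y <= Y'}.
    by move=> y yY; rewrite memY'; apply: BC; rewrite !mem_cat map_f ?orbT // mem_cat yY.
  have st12 := steps_trans st1 stC.
  have [||p' [Z' [gZ' st' [pN pE pZ'] pb pp]]] :=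
      @fresh_copies Z2 Y Y' p [seq j <- iota 0 k.+1 | j != i] gC sY sY' YY'.
  + by rewrite filter_uniq ?iota_uniq.
  + move=> j y; rewrite mem_filter mem_iota /= => /andP [_ jk] yY.
    by apply: steps_sub st12 _; apply: pZ.
  have p'i : p' i = p i by rewrite pN // mem_filter eqxx.
  have piY' y : y \in Y' -> Z2 (p i y) by rewrite memY' => ?; apply: sub_clos.
  have memL j : j <= k -> j != i -> j \in [seq j <- iota 0 k.+1 | j != i].
    by move=> jk ji; rewrite mem_filter ji mem_iota.
  have p'Z j y : j <= k -> y \in Y' -> Z' (p' j y).
    move=> jk yY; case: (eqVneq j i) => [->|ji]; last by apply: pZ' => //; apply: memL.
    by rewrite p'i; apply: steps_sub st' _; apply: piY'.
  pose p'' j := if j == k.+1 then p' i else p' j.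
  have p''E j : j <= k -> p'' j = p' j by rewrite /p''; case: eqP => // ->; rewrite ltnn.
  have ik : i <= k := target_le k.
  have pairs2 : pairs k Z2 (Leaves Z Y p) (Leaves Z' Y' p'').
    move=> j l jk lk jl /=; rewrite !p''E //.
    case: (eqVneq j i) => [ji|ji]; case: (eqVneq l i) => [li|li].
    * by rewrite ji li eqxx in jl.
    * by rewrite ji p'i; apply: pb => //; apply: memL.
    * by rewrite li p'i; apply: psteps_sym; apply: pb => //; apply: memL.
    * by apply: pp => //; apply: memL.
  have pairsZ Z0 : steps m u Z0 Z2 -> pairs k Z0 (Leaves Z Y p) (Leaves Z' Y' p'').
    by move=> st0 j l jk lk jl; apply: psteps_trans (steps_psteps _ _ _ st0) (pairs2 j l jk lk jl).
  exists (Leaves Z' Y' p''); split.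
    split=> //=; first by apply: steps_fingen st' _; exists C.
    move=> j y; rewrite leq_eqVlt => /orP [/eqP ->|jk] yY; last by rewrite p''E //; apply: p'Z.
    by rewrite /p'' eqxx; apply: p'Z.
  split=> /=.
  + split=> // [|j jk y yY]; first exact: steps_trans st12 st'.
    rewrite p''E //; case: (eqVneq j i) => [->|ji]; first by rewrite p'i.
    by apply: pE => //; apply: memL.
  + split; first by rewrite /p'' eqxx; case: eqP => // E; move: ik; rewrite -/i -/i E ltnn.
    exact: pairsZ.
  + rewrite p''E // p'i; split=> x xX.
      by rewrite memY'; apply: BC; rewrite !mem_cat map_f ?orbT // mem_cat xX orbT.
    by rewrite mem_map_autV memY' abK; apply: BC; rewrite !mem_cat xX !orbT.
  + exists C; rewrite p''E // p'i; split=> //.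
      by move=> x xB; apply: BC; rewrite mem_cat xB.
    by move=> x; rewrite mem_map_autV memY' abK.
  + move=> A D tE sA sD AD AZ; have [h [hA fs hD E]] := tk A D tE sA sD AD AZ.
    by exists h; split=> //; apply: pairsZ; rewrite -E.
pose Z k := lv_world (s k); pose Y k := lv_dom (s k); pose q b k := lv_pos (s k) (leaf b k).
have YS k : {subset Y k <= Y k.+1} by case: (sR k) => -[].
have leaf_pos b k : q b k.+1 = lv_pos (s k.+1) (leaf b k).
  rewrite /q leafS; case: ifP => // /andP [/eqP -> _].
  by case: (sR k) => _ [].
have qE b k : {in Y k, q b k.+1 =1 q b k}.
  by move=> y yY; rewrite leaf_pos; case: (sR k) => -[_ _ H] _ _ _ _; apply: H => //; apply: leaf_le.
have YV x : exists k, x \in Y k.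
  by exists (pickle x).+2; case: (sR (pickle x).+1) => _ _ [H _] _ _; apply/H/mem_first_points.
have stZ j k : j <= k -> steps m u (Z j) (Z k).
  by apply: chain_steps => i; case: (sR i) => -[].
have /choice [p pE] : forall b, exists a : aut, forall k, {in Y k, a =1 q b k}.
  move=> b; apply: aut_limit => // x.
  (* The leaf of [b] is prescribed at arbitrarily late times, which exhausts the range. *)
  have [k [le lk _ _]] := leaf_next b (pickle x).+1; exists k.+1.
  rewrite leaf_pos lk; case: (sR k) => _ _ [_ H] _ _; apply/H/mem_first_points.
  exact: leq_trans le.
exists p => b c bc; have [k0 [lb lc ne]] := leaf_separate bc.
have [_ _ _ [C [sC BC YC gC stC]] _] := sR k0.
exists C; split=> //.
(* Stage [0] is the closure of [C] with the domain of time [k0.+1], on which both branches still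
   agree; stage [k'.+1] is time [k0.+1 + k']. *)
pose Zk k := if k is k'.+1 then Z (k0.+1 + k') else clos u (mset C).
pose Yk k := if k is k'.+1 then Y (k0.+1 + k') else Y k0.+1.
have start d : leaf d k0 = target k0 -> {in Y k0.+1, p d =1 lv_pos (s k0.+1) (target k0)}.
  by move=> ld y yY; rewrite (pE d k0.+1 y yY) leaf_pos ld.
have pair k Z0 : pairs (k0.+1 + k) Z0 (s (k0.+1 + k)) (s (k0.+1 + k).+1) ->
    psteps (p c) (p b) Z0 (Y (k0.+1 + k)) (Z (k0.+1 + k.+1)) (Y (k0.+1 + k.+1)).
  move=> pr; rewrite addnS.
  have := pr _ _ (leaf_le c (k0.+1 + k)) (leaf_le b (k0.+1 + k)).
  rewrite eq_sym; have /eqP -> := leaf_apart (leq_addr k k0.+1) ne; move/(_ isT).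
  by apply: psteps_congr => y yY; rewrite (pE _ _ _ yY) leaf_pos.
suff pc : pchain m u (p c) (p b) Zk Yk.
  apply: (pchain_generic pc) => //.
  - by move=> x; rewrite -YC; apply/mapP/mapP => -[y yY ->]; exists y => //; rewrite start.
  - by move=> y yY; rewrite !start.
split.
- case=> [|k] /=; first by rewrite addn0; apply: steps_psteps.
  by apply: pair; case: (sR (k0.+1 + k)) => _ [].
- exact: clos_uclosed.
- by move=> y yY /=; rewrite !start //; split; apply: sub_clos; rewrite -YC map_f.
- move=> x; have [k xk] := YV (ab (p c) x); exists k.+1 => /=.
  apply: steps_sub (stZ k _ (leq_addl _ _)) _.
  have := sP k => -[_ _ _ /(_ (leaf c k) _ (leaf_le c k) xk)].
  by rewrite -/(q c k) -pE // abK.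
- move=> x; have [k xk] := YV x; exists k.+1 => /=.
  have mono i j : i <= j -> {subset Y i <= Y j}.
    elim: j => [|j IH]; first by rewrite leqn0 => /eqP ->.
    by rewrite leq_eqVlt => /orP [/eqP -> //|/IH H z /H /YS].
  exact: mono (leq_addl _ _) _ xk.
- move=> k A D sA sD AD AZ; have [j kj tE] := task_infinite A D (k0.+1 + k).
  pose l := j - k0.+1; have jE : j = k0.+1 + l by rewrite /l subnKC //; lia.
  have AZj x : x \in A -> Z j x.
    move=> /AZ; case: (k) kj => [|k'] kj /=.
      by move/(steps_sub stC); apply: steps_sub; apply: stZ; lia.
    by apply: steps_sub; apply: stZ; lia.
  have [_ _ _ _ /(_ A D tE sA sD AD AZj) [h [hA fs hD pr]]] := sR j.
  exists l.+1, h; rewrite /= -jE; split=> //; first lia.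
  by have := @pair l (ext u (Z j) (map h D)); rewrite addnS -jE; apply.
Qed.

End PerfectFamily.

(** * The small index property *)

Section SmallIndex.
Variables (m : nat) (V : countType) (e : rel V).
Hypothesis HM : is_generic m e.
Local Notation strong := (strong e m).
Local Notation aut := (aut e).
Implicit Types (Z S : V -> Prop) (D A B C T Y : seq V).
Local Notation mset C := (fun x => x \in (C : seq V)).

(** * Goodness for the empty family of automorphisms *)

Section NoAction.
Variable u : void -> aut.

Lemma clos_void Z : clos u Z = Z.
Proof. by apply: clos_id => -[]. Qed.

Lemma ext_void C D : ext u (mset C) D = mset (C ++ D).
Proof.
rewrite /ext clos_void; apply/predeqP => x; rewrite mem_cat.
by split=> [[|] ->|/orP []]; rewrite ?orbT; auto.
Qed.

Lemma free_step_void Z D : strong D -> strong (cap D Z) ->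
  (forall x y, x \in D -> ~ Z x -> Z y -> y \notin D -> ~~ e x y) -> free_step m u Z D.
Proof.
move=> sD sA DZ; split=> //.
move=> N f _ hZ hD; exists f; split=> //.
rewrite clos_void => x y.
have cross x' y' : x' \in D -> ~ Z x' -> Z y' -> y' \notin D -> e x' y' -> False.
  by move=> xD nZx Zy nDy; apply/negP; apply: DZ.
case: (pselect (Z x)) => Zx; case: (pselect (Z y)) => Zy; first by move=> _ _; apply: hZ.
- case=> [_|xD] [//|yD] exy; last exact: hD.
  case xD: (x \in D); first exact: hD.
  by case: (cross y x) => //; rewrite ?xD // (HM.1.1 y x).
- case=> [//|xD] _ exy; case yD: (y \in D); first exact: hD.
  by case: (cross x y) => //; rewrite yD.
- by case=> // xD [] // yD; apply: hD.
Qed.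

(** Without generators a free step is a free amalgam, so [independent_extension] solves the
    scheduled problems; adding strong hulls of initial segments exhausts [V]. *)
Lemma good_void C : strong C -> good m u (clos u (mset C)).
Proof.
move=> sC.
have [||s [s0 sP sR]] := @dependent_choice_nat (seq V) (fun _ => strong)
    (fun k A B => [/\ steps m u (mset A) (mset B), {subset first_points V k <= B} &
      forall A' D, task V k = Some (A', D) -> strong A' -> strong D -> {subset A' <= D} ->
        {subset A' <= A} -> exists h : aut, [/\ {in A', h =1 id},
          free_step m u (mset A) (map h D), forall x, x \in D -> h x \in A -> x \in A' &
          steps m u (ext u (mset A) (map h D)) (mset B)]]) C => //.
- move=> k A sA.
  have [A1 [sA1 st1 tk]] : exists A1, [/\ strong A1, steps m u (mset A) (mset A1) &
      forall A' D, task V k = Some (A', D) -> strong A' -> strong D -> {subset A' <= D} ->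
        {subset A' <= A} -> exists h : aut, [/\ {in A', h =1 id},
          free_step m u (mset A) (map h D), forall x, x \in D -> h x \in A -> x \in A' &
          ext u (mset A) (map h D) = mset A1]].
    case: (pselect (exists A' D, [/\ task V k = Some (A', D), strong A', strong D,
        {subset A' <= D} & {subset A' <= A}])) => [[A' [D [tE sA' sD AD AA]]]|nP].
      have [h [hA hD hE sAD]] := independent_extension HM sA' sA sD AA AD.
      have fs : free_step m u (mset A) (map h D).
        apply: free_step_void; first exact: strong_map.
          apply: strong_eqi sA' => x; apply/idP/capP => [xA|[xA /mapP [y yD E]]].
            by split; [apply: AA|rewrite -(hA x xA); apply/map_f/AD].
          have yA : y \in A' by apply: hD; rewrite -?E.
          by rewrite E hA.
        move=> _ y /mapP [x xD ->] nxA yA nyD; apply: hE => //.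
          by apply/negP => xA; apply: nxA; rewrite hA //; apply: AA.
        by apply: contra nyD => yA'; rewrite -(hA y yA'); apply/map_f/AD.
      exists (A ++ map h D); split=> //; first by rewrite -ext_void; apply: steps_one.
      by rewrite tE => _ _ [<- <-] *; exists h; rewrite ext_void.
    exists A; split=> //; first exact: steps_refl.
    by move=> A' D *; case: nP; exists A', D.
  have [A2 sA2 sub2] := strong_hull HM (A1 ++ first_points V k).
  have sub12 : {subset A1 <= A2} by move=> x xA; apply: sub2; rewrite mem_cat xA.
  have fs : free_step m u (mset A1) A2.
    apply: free_step_void => // [|x y _ _ /sub12 -> //].
    apply: strong_eqi sA1 => x; rewrite mem_cap asboolb.
    by case xA: (x \in A1) => //=; rewrite sub12.
  have st2 : steps m u (mset A1) (mset (A1 ++ A2)) by rewrite -ext_void; apply: steps_one.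
  exists (A1 ++ A2); split.
    apply: strong_eqi sA2 => x; rewrite mem_cat.
    by case xA: (x \in A1) => //=; rewrite sub12.
  split; first exact: steps_trans st1 st2.
    by move=> x xk; rewrite mem_cat; apply/orP; right; apply: sub2; rewrite mem_cat xk orbT.
  move=> A' D tE sA' sD AD AA; have [h [hA fsh hD E]] := tk A' D tE sA' sD AD AA.
  by exists h; rewrite E.
split; first exact: clos_uclosed.
exists (fun k => mset (s k)); last by rewrite s0 clos_void; apply: steps_refl.
have st k : steps m u (mset (s k)) (mset (s k.+1)) by case: (sR k).
split=> // [x|k A D sA sD AD AZ].
  by exists (pickle x).+2; case: (sR (pickle x).+1) => _ H _; apply/H/mem_first_points.
have [j kj tE] := task_infinite A D k.
have AZj : {subset A <= s j}.
  move=> x /AZ; exact: steps_sub (@chain_steps _ _ _ _ u (fun k => mset (s k)) k j st kj).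
by have [_ _ /(_ A D tE sA sD AD AZj) [h [hA fs hD sth]]] := sR j; exists j, h.
Qed.

End NoAction.

(** Freed from a particular base, goodness can be passed down the binary tree. *)
Definition ready (I : Type) (u : I -> aut) := forall B, exists C,
  [/\ strong C, {subset B <= C} & good m u (clos u (mset C))].

Lemma good_ready (I : Type) (u : I -> aut) C : good m u (clos u (mset C)) -> ready u.
Proof.
move=> gC B; have [|C' [sC' BC' gC' _]] := good_reach_strong HM B gC; first by exists C.
by exists C'.
Qed.

Variable H : (V -> V) -> Prop.
Hypotheses (Hsub : is_aut_subgroup e H) (Hsmall : ~ index_ge_continuum e H).

Lemma subgroup_inv (g : aut) : H g -> H (ab g).
Proof. by case: Hsub => _ [_ [_ Hinv]] Hg; apply: Hinv Hg _ => x; rewrite afK abK. Qed.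

Lemma subgroup_comp f g : H f -> H g -> H (f \o g).
Proof. by case: Hsub => _ [_ [Hcomp _]]; apply: Hcomp. Qed.

(** If no quotient [p s (p t)^-1] with [s <> t] were in [H], the inverses of the perfect family
    would represent continuum many left cosets. *)
Lemma generic_in_subgroup (I : Type) (u : I -> aut) B : ready u -> exists C (w : aut),
  [/\ {subset B <= C}, good m u (clos u (mset C)), generic_over m u C w & H w].
Proof.
move=> ru; have [C0 [_ _ gC0]] := ru [::].
have [p pE] := perfect_family HM B gC0; apply: contrapT => nH; apply: Hsmall.
exists (fun s => ab (p s)); split=> [s|s t [h [Hh hE]]]; first exact: (aut_is_aut (ainv (p s))).
apply: contrapT => st; have [C [BC gC gw]] := pE s t st.
apply: nH; exists C, (acomp (p s) (ainv (p t))); split=> //.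
suff -> : af (acomp (p s) (ainv (p t))) = h by [].
by apply/funext => x; rewrite /= hE abK.
Qed.

(** An automorphism agreeing with [g] on [C] differs from it by one fixing [C], which
    [three_factors] puts in [H]. *)
Lemma open_of_generic (I : Type) (u : I -> aut) C : strong C -> good m u (clos u (mset C)) ->
  (forall w : aut, generic_over m u C w -> H w) -> open_in_Aut e H.
Proof.
move=> sC gC CH g Hg; exists C => g' /is_aut_aut [b <-] bg.
have [a aE] : exists a : aut, af a = g by apply: is_aut_aut; apply: Hsub.1.
have [|w1 [w2 [w3 [g1 g2 g3 E]]]] := three_factors HM (g := acomp (ainv a) b) sC gC.
  by move=> c cC /=; rewrite bg // -aE afK.
have -> : af b = g \o (w1 \o (w2 \o w3)).
  by apply/funext => x; rewrite /= -E /= -aE abK.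
apply: subgroup_comp => //; apply: subgroup_comp; first exact: CH.
by apply: subgroup_comp; apply: CH.
Qed.

(** * The binary tree of partial conjugations *)

Hypothesis Hopen : ~ open_in_Aut e H.

Lemma generic_split (I : Type) (u : I -> aut) B : ready u -> exists C (w w' a : aut),
  [/\ {subset B <= C}, H w /\ ~ H w', ready (ocons u w) /\ ready (ocons u w'), {in C, a =1 id} &
    (forall i x, a (u i x) = u i (a x)) /\ forall x, a (w x) = w' (a x)].
Proof.
move=> ru; have [C [w [BC gC gw Hw]]] := generic_in_subgroup B ru.
have [w' gw' nHw'] : exists2 w' : aut, generic_over m u C w' & ~ H w'.
  apply: contrapT => nE; apply: Hopen; apply: (open_of_generic (go_strong gw) gC) => w' gw'.
  by apply: contrapT => nH; apply: nE; exists w'.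
have [a [aC au aw]] := generic_over_conj HM gw gw'.
exists C, w, w', a; split=> //; split; [exact: good_ready (go_good gw)|exact: good_ready (go_good gw')].
Qed.

(** [nd_conj] is the product of the inverse twists met so far, and [nd_fix] the finite set on which
    all later twists must be the identity. *)
Record node := Node {
  nd_index : Type; nd_maps : nd_index -> aut; nd_ready : ready nd_maps;
  nd_conj : aut; nd_fix : seq V }.

Record branching (n : node) := Branching {
  br_base : seq V; br_in : aut; br_out : aut; br_twist : aut;
  br_fix : {subset nd_fix n <= br_base};
  br_H : H br_in /\ ~ H br_out;
  br_ready : forall b : bool, ready (ocons (nd_maps (n := n)) (if b then br_out else br_in));
  br_id : {in br_base, br_twist =1 id};
  br_comm : forall i x, br_twist (nd_maps (n := n) i x) = nd_maps i (br_twist x);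
  br_conj : forall x, br_twist (br_in x) = br_out (br_twist x) }.

Lemma branchingP (n : node) : branching n.
Proof.
have ex : exists d : seq V * aut * aut * aut, let: (C, w, w', a) := d in
    [/\ {subset nd_fix n <= C}, H w /\ ~ H w',
      ready (ocons (nd_maps (n := n)) w) /\ ready (ocons (nd_maps (n := n)) w'), {in C, a =1 id} &
      (forall i x, a (nd_maps (n := n) i x) = nd_maps i (a x)) /\ forall x, a (w x) = w' (a x)].
  have [C [w [w' [a P]]]] := generic_split (nd_fix n) (nd_ready n).
  by exists (C, w, w', a).
have [[[[C w] w'] a] [BC Hw [r r'] aC [au aw]]] := cid ex.
by apply: (@Branching n C w w' a) => // -[].
Qed.

(** The new [nd_fix] takes in points together with their preimages under [h], so that the limit
    along a branch is onto. *)
Definition child (k : nat) (b : bool) (n : node) : node :=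
  let d := branchingP n in
  let h := if b then acomp (nd_conj n) (ainv (br_twist d)) else nd_conj n in
  @Node (option (nd_index n)) (ocons (nd_maps (n := n)) (if b then br_out d else br_in d))
    (br_ready d b) h
    (br_base d ++ first_points V k ++ map (ab h) (first_points V k)).

Lemma ready_void (u : void -> aut) : ready u.
Proof.
move=> B; have [C sC BC] := strong_hull HM B; exists C; split=> //.
exact: good_void.
Qed.

Fixpoint path (s : nat -> bool) (k : nat) : node :=
  if k is k'.+1 then child k' (s k') (path s k')
  else Node (ready_void (of_void aut)) (aid e) [::].

Lemma path_eq s t k : (forall j, j < k -> s j = t j) -> path s k = path t k.
Proof.
elim: k => //= k IH st; rewrite st // IH // => j jk; apply: st; exact: leqW.
Qed.

Lemma path_fixed s k : {subset nd_fix (path s k) <= nd_fix (path s k.+1)} /\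
  {in nd_fix (path s k), nd_conj (path s k.+1) =1 nd_conj (path s k)}.
Proof.
have sub := br_fix (branchingP (path s k)); split=> y yk /=.
  by rewrite mem_cat sub.
case: (s k) => //=; congr (nd_conj _ _).
by rewrite -[in LHS](br_id (sub _ yk)) afK.
Qed.

Lemma path_limit s : exists a : aut, forall k, {in nd_fix (path s k), a =1 nd_conj (path s k)}.
Proof.
apply: aut_limit => [k|k|x|x]; [exact: (path_fixed s k).1|exact: (path_fixed s k).2| |].
  by exists (pickle x).+2; rewrite /= !mem_cat mem_first_points ?orbT.
exists (pickle x).+2; set n := path s _; rewrite mem_map_autV.
by rewrite /n /= !mem_cat map_f ?orbT // mem_first_points.
Qed.

Definition conjugates (n : node) (w v : aut) := (exists i, nd_maps (n := n) i = w) /\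
  forall x, nd_conj n (w x) = v (nd_conj n x).

(** A twist commutes with all automorphisms already chosen at the node, so composing with its
    inverse keeps earlier conjugacy relations. *)
Lemma child_conjugates k b n w v : conjugates n w v -> conjugates (child k b n) w v.
Proof.
move=> [[i iw] E]; split; first by exists (Some i).
case: b => //= x; set d := branchingP n; rewrite -E; congr (nd_conj _ _).
apply: (can_inj (afK (br_twist d))); rewrite abK -iw br_comm iw.
by rewrite abK.
Qed.

Lemma path_conjugates s j k w v : j <= k -> conjugates (path s j) w v -> conjugates (path s k) w v.
Proof.
elim: k => [|k IH]; first by rewrite leqn0 => /eqP ->.
rewrite leq_eqVlt => /orP [/eqP -> //|/IH {}IH] /IH; exact: child_conjugates.
Qed.

(** Thanks to the twist, the limits on both sides of a splitting conjugate the automorphism chosen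
    there to the same [v]. If [F t = F s h] with [h] in [H], then [h] conjugates [br_in] to [br_out]
    or conversely, although only [br_in] lies in [H]. *)
Lemma index_continuum : index_ge_continuum e H.
Proof.
have [F FE] := choice path_limit.
exists (fun s => F s); split=> [s|s t [h [Hh hE]]]; first exact: aut_is_aut.
apply: contrapT => st.
have ex : exists k, s k != t k.
  apply: contrapT => nE; apply: st; apply/funext => k.
  by apply: contrapT => E; apply: nE; exists k; apply/eqP.
case: (ex_minnP ex) => k stk min.
have eqp : path t k = path s k.
  by apply: path_eq => j jk; apply/eqP/negPn/negP; rewrite eq_sym => /min; rewrite leqNgt jk.
set n := path s k in eqp; pose d := branchingP n.
pose v := acomp (nd_conj n) (acomp (br_in d) (ainv (nd_conj n))).
have branch r : path r k = n ->
    forall x, F r ((if r k then br_out d else br_in d) x) = v (F r x).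
  move=> rn; set w := if r k then _ else _.
  have base : conjugates (path r k.+1) w v.
    rewrite /= rn; split; first by exists None.
    rewrite /w; case: (r k) => x /=; last by rewrite afK.
    rewrite -/d; congr (nd_conj _ _); apply: (can_inj (afK (br_twist d))).
    by rewrite abK br_conj afK abK.
  (* At depth [l] both [x] and [w x] lie in [nd_fix], where the limit equals [nd_conj]. *)
  move=> x; pose l := k.+1 + maxn (pickle x).+2 (pickle (w x)).+2.
  have inl y : (pickle y).+2 <= l -> y \in nd_fix (path r l).
    case: l => // l; rewrite ltnS => le /=.
    by rewrite !mem_cat mem_first_points ?orbT.
  have [_ E] := path_conjugates (leq_addr _ _) base : conjugates (path r l) w v.
  by rewrite !(FE r l) //; apply: inl; rewrite /l; lia.
have Hin := (br_H d).1; have nHout := (br_H d).2.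
have [b bE] : exists b : aut, af b = h by apply: is_aut_aut; apply: Hsub.1.
have Hb : H b by rewrite bE.
have key x : h ((if t k then br_out d else br_in d) x) = (if s k then br_out d else br_in d) (h x).
  apply: (@af_inj _ _ (F s)); rewrite -hE branch // branch //.
  by rewrite hE.
apply: nHout; case sk: (s k) stk key; case tk: (t k) => // _ key.
  have -> : af (br_out d) = b \o (br_in d \o ab b).
    by apply/funext => x; rewrite /= bE key -bE abK.
  by apply: subgroup_comp => //; apply: subgroup_comp => //; apply: subgroup_inv.
have -> : af (br_out d) = ab b \o (br_in d \o b).
  by apply/funext => x; rewrite /= bE -key -bE afK.
apply: subgroup_comp; first exact: subgroup_inv.
exact: subgroup_comp.
Qed.

End SmallIndex.

Theorem theorem7 (m : nat) (Hm : 2 <= m) (V : countType) (e : rel V)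
  (HM : is_generic m e) (H : (V -> V) -> Prop) :
  is_aut_subgroup e H ->
  ~ index_ge_continuum e H ->
  open_in_Aut e H.
Proof.
move=> Hsub Hsmall; apply: contrapT => Hopen.
exact: Hsmall (index_continuum HM Hsub Hsmall Hopen).
Qed.
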